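(* For every tuple $(R_1,\dots,R_D)\in(0,1)^D$ there exists $\rho>0$ such that for every $n\in\mathbb{N}$, every $t\in\mathbb{N}$ and all $k_1,\dots,k_D$ with $k_i\le nR_i$ ($i\in[D]$), a tuple of codes $(\mathcal{C}_1,\dots,\mathcal{C}_D)\in{\sf Gr}_{2^t}(n,k_1)\times\cdots\times{\sf Gr}_{2^t}(n,k_D)$ picked uniformly at random is $\rho$-product-expanding with probability at least $1-n^D2^{n^D-t+1}$ (which tends to $1$ as $t\to\infty$).
   Context: ${\sf Gr}_q(n,k)$ denotes the set of all $k$-dimensional linear subspaces (linear codes) of $\mathbb{F}_q^n$. For a finite set $S$, $\mathbb{F}_q^S$ is the space of vectors indexed by $S$; $|v|$ is the Hamming weight of $v$ and $\|v\|=|v|/|S|$ its normalized weight. For $n,D\in\mathbb{N}$ and $i\in[D]$, $\mathcal{L}_i$ is the set of lines parallel to the $i$-th axis in the grid $[n]^D$, i.e. sets $A_1\times\cdots\times A_D$ with $A_i=[n]$ and $|A_j|=1$ for $j\ne i$. For linear codes $\mathcal{C}_1,\dots,\mathcal{C}_D\subseteq\mathbb{F}_q^n$, let $\mathcal{C}^{(i)}=\{c\in\mathbb{F}_q^{[n]^D}: c|_\ell\in\mathcal{C}_i\text{ for all }\ell\in\mathcal{L}_i\}$ (a line $\ell\in\mathcal{L}_i$ is identified with $[n]$ via the $i$-th coordinate), and $\mathcal{C}_1\boxplus\cdots\boxplus\mathcal{C}_D=\mathcal{C}^{(1)}+\cdots+\mathcal{C}^{(D)}$. For $x\in\mathbb{F}_q^{[n]^D}$,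 $|x|_i$ is the number of lines $\ell\in\mathcal{L}_i$ with $x|_\ell\ne0$, and $\|x\|_i=|x|_i/n^{D-1}$. The collection $(\mathcal{C}_1,\dots,\mathcal{C}_D)$ is $\rho$-product-expanding if every $c\in\mathcal{C}_1\boxplus\cdots\boxplus\mathcal{C}_D$ can be written as $c=\sum_{i\in[D]}a_i$ with $a_i\in\mathcal{C}^{(i)}$ and $\rho\sum_{i\in[D]}\|a_i\|_i\le\|c\|$. *)

(* Defs.v *)
From HB Require Import structures.
From mathcomp Require Import all_boot all_order all_algebra.
From mathcomp Require Import reals.
Set Implicit Arguments. Unset Strict Implicit. Unset Printing Implicit Defensive.
Import Order.TTheory GRing.Theory Num.Theory.
Local Open Scope ring_scope.

(* The grid [n]^D is the finite type {ffun 'I_D -> 'I_n};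
   vectors in F^([n]^D) are {ffun {ffun 'I_D -> 'I_n} -> F}. *)

Definition hweight (F : finFieldType) (D n : nat)
  (x : {ffun {ffun 'I_D -> 'I_n} -> F}) : nat :=
  #|[set g : {ffun 'I_D -> 'I_n} | x g != 0]|.

Definition is_code (F : finFieldType) (n k : nat) (C : {set 'rV[F]_n}) : bool :=
  [exists M : 'M[F]_n, (\rank M == k) && (C == [set v | (v <= M)%MS])].

Definition Gr (F : finFieldType) (n k : nat) : {set {set 'rV[F]_n}} :=
  [set C : {set 'rV[F]_n} | is_code k C].

Definition set_coord (D n : nat) (g : {ffun 'I_D -> 'I_n}) (i : 'I_D) (a : 'I_n)
  : {ffun 'I_D -> 'I_n} := [ffun j => if j == i then a else g j].

(* restriction of x to the line through g parallel to axis i, identified with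
   [n] via the i-th coordinate *)
Definition restr (F : finFieldType) (D n : nat)
  (x : {ffun {ffun 'I_D -> 'I_n} -> F}) (i : 'I_D) (g : {ffun 'I_D -> 'I_n})
  : 'rV[F]_n := \row_(a < n) x (set_coord g i a).

Definition line (D n : nat) (i : 'I_D) (g : {ffun 'I_D -> 'I_n})
  : {set {ffun 'I_D -> 'I_n}} :=
  [set h : {ffun 'I_D -> 'I_n} | [forall j, (j != i) ==> (h j == g j)]].

Definition lines (D n : nat) (i : 'I_D) : {set {set {ffun 'I_D -> 'I_n}}} :=
  [set line i g | g : {ffun 'I_D -> 'I_n}].

Definition axis_weight (F : finFieldType) (D n : nat) (i : 'I_D)
  (x : {ffun {ffun 'I_D -> 'I_n} -> F}) : nat :=
  #|[set l in lines n i | [exists h in l, x h != 0]]|.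

Definition tensor_code (F : finFieldType) (D n : nat) (i : 'I_D)
  (C : {set 'rV[F]_n}) : {set {ffun {ffun 'I_D -> 'I_n} -> F}} :=
  [set c : {ffun {ffun 'I_D -> 'I_n} -> F} | [forall g, restr c i g \in C]].

Definition in_boxplus (F : finFieldType) (D n : nat)
  (Cs : {ffun 'I_D -> {set 'rV[F]_n}}) (c : {ffun {ffun 'I_D -> 'I_n} -> F}) : bool :=
  [exists a : {ffun 'I_D -> {ffun {ffun 'I_D -> 'I_n} -> F}},
     [forall i, a i \in tensor_code i (Cs i)] && (c == \sum_(i < D) a i)].

Definition nweight (R : realType) (F : finFieldType) (D n : nat)
  (x : {ffun {ffun 'I_D -> 'I_n} -> F}) : R :=
  (hweight x)%:R / #|{ffun 'I_D -> 'I_n}|%:R.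

Definition naxis_weight (R : realType) (F : finFieldType) (D n : nat) (i : 'I_D)
  (x : {ffun {ffun 'I_D -> 'I_n} -> F}) : R :=
  (axis_weight i x)%:R / (n ^ D.-1)%:R.

Definition product_expanding (R : realType) (F : finFieldType) (D n : nat)
  (rho : R) (Cs : {ffun 'I_D -> {set 'rV[F]_n}}) : bool :=
  [forall c : {ffun {ffun 'I_D -> 'I_n} -> F}, in_boxplus Cs c ==>
    [exists a : {ffun 'I_D -> {ffun {ffun 'I_D -> 'I_n} -> F}},
      [&& [forall i, a i \in tensor_code i (Cs i)],
          c == \sum_(i < D) a i &
          rho * \sum_(i < D) naxis_weight R i (a i) <= nweight R c]]].

Definition code_tuples (F : finFieldType) (D n : nat) (k : 'I_D -> nat)
  : {set {ffun 'I_D -> {set 'rV[F]_n}}} :=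
  [set Cs : {ffun 'I_D -> {set 'rV[F]_n}} | [forall i, Cs i \in Gr F n (k i)]].

Definition prob_expanding (R : realType) (F : finFieldType) (D n : nat)
  (k : 'I_D -> nat) (rho : R) : R :=
  #|[set Cs in code_tuples F n k | product_expanding rho Cs]|%:R
    / #|code_tuples F n k|%:R.

(* Main.v *)
(** Call a set U of grid points s-closed if every line is contained in U or
    meets U in at most s points, and call a tuple of codes exact on U if every
    word of the box-sum supported on U is a sum of codewords living on lines
    contained in U (dually: local sections of the dual product code on U
    extend).

    - The support S of a word lies in a closed set U with |U| = O(|S|), namely
      the common zeros of all polynomial functions of small individual degrees
      vanishing on S. If the codes are exact on U, the lines contained in U
      number O(|S| / n), which gives the expansion.
    - For a fixed U, exactness is an open condition on the generator matrices,
      so a Schwartz-Zippel count along lines through one good tuple bounds the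
      probability of failure, and there are at most 2^(n^D - 1) sets U with
      less than half of the points.
    - The good tuple may depend on U. Split every axis into eight blocks of
      length about n / 8, chosen at random so that lines meeting U sparsely
      stay sparse in each block, and use the same generic code in all blocks:
      exactness on the cells, known by induction and genericity, gives
      exactness on U. The relative losses in sparsity form a geometric series,
      so one reaches a constant length.
    - At constant length, split randomly into blocks of bounded length B. With
      positive probability, in every cell and in every direction i, the points
      of U whose i-line is not contained in U have at most 2 D + 1 distinct
      i-th coordinates. Reed-Solomon codes are exact there: projecting along
      the code while fixing these coordinates preserves supports in U. *)

Require Import Defs.
From HB Require Import structures.
From mathcomp Require Import all_boot all_order all_algebra.
From mathcomp Require Import reals.
From mathcomp Require Import zify ring lra.
Set Implicit Arguments. Unset Strict Implicit. Unset Printing Implicit Defensive.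
Import Order.TTheory GRing.Theory Num.Theory.
Local Open Scope ring_scope.

(** * Ranks along a line of matrices *)

Lemma card_bigcup_le (T I : finType) (S : I -> {set T}) :
  (#|\bigcup_i S i| <= \sum_i #|S i|)%N.
Proof.
elim/big_ind2: _ => [|A x B y hA hB|//]; first by rewrite cards0.
by apply: leq_trans (leq_card_setU _ _) _; exact: leq_add.
Qed.

Lemma size_det_affine (F : fieldType) (r : nat) (P : 'M[{poly F}]_r) :
  (forall i j, (size (P i j) <= 2)%N) -> (size (\det P) <= r.+1)%N.
Proof.
move=> hP; rewrite /determinant.
apply: (leq_trans (size_sum _ _ _)); apply/bigmax_leqP => s _.
have -> : (-1) ^+ perm.odd_perm s = ((-1) ^+ perm.odd_perm s)%:P :> {poly F}.
  by rewrite rmorphXn rmorphN1.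
rewrite mul_polyC; apply: (leq_trans (size_scale_leq _ _)).
apply: (leq_trans (size_prod_leq _ _)).
set S := (\sum_(i < r) _)%N; have : (S <= \sum_(i < r) 2)%N by apply: leq_sum.
by rewrite sum_nat_const cardE size_enum_ord; lia.
Qed.

Lemma rank_rowsub (F : fieldType) (m n p : nat) (f : 'I_p -> 'I_m) (A : 'M[F]_(m, n)) :
  (\rank (rowsub f A) <= \rank A)%N.
Proof. by rewrite rowsubE mxrankM_maxr. Qed.

(** Some minor of [A0] of size [\rank A0] is nonzero. The same minor of [A0 + t *: A1] is a
    polynomial in [t] of degree at most [\rank A0], nonzero at 0, and it vanishes wherever the rank
    drops. *)
Lemma size_rank_drop (F : fieldType) (m n : nat) (A0 A1 : 'M[F]_(m, n)) (ts : seq F) :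
  uniq ts -> all (fun t => (\rank (A0 + t *: A1)%R < \rank A0)%N) ts -> (size ts <= n)%N.
Proof.
move=> uts hts.
set r := \rank A0.
have rn : (r <= n)%N by exact: rank_leq_col.
pose f := maxrankfun A0.
have hf : \rank (rowsub f A0) = r by rewrite /f eq_maxrowsub.
have hfT : row_full (rowsub f A0)^T by rewrite /row_full mxrank_tr hf.
pose g := fullrankfun hfT.
pose P : 'M[{poly F}]_r :=
  \matrix_(i, j) ((A0 (f j) (g i))%:P + A1 (f j) (g i) *: 'X).
have hsize : (size (\det P) <= r.+1)%N.
  apply: size_det_affine => i j; rewrite mxE.
  apply: (leq_trans (size_polyD _ _)); rewrite geq_max; apply/andP; split.
    exact: leq_trans (size_polyC_leq1 _) _.
  by apply: leq_trans (size_scale_leq _ _) _; rewrite size_polyX.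
have hev t : (\det P).[t] = \det (rowsub g (rowsub f (A0 + t *: A1))^T).
  have -> : (\det P).[t] = \det (map_mx (horner_eval t) P) by rewrite det_map_mx.
  by congr (\det _); apply/matrixP => i j; rewrite !mxE /horner_eval !hornerE mulrC.
have d0 : \det P != 0.
  apply/eqP => d0; have := hev 0; rewrite d0 horner0 scale0r addr0 => /esym/eqP.
  apply/negP; rewrite -unitfE -/(unitmx _).
  exact: fullrowsub_unit.
apply: (@leq_trans r); last exact: rn.
rewrite -ltnS; apply: leq_trans hsize.
apply: max_poly_roots => //; apply/allP => t /(allP hts) ht.
rewrite rootE hev; apply: contraLR ht; rewrite -unitfE -/(unitmx _) -leqNgt => hu.
rewrite -/r -[r in (r <= _)%N](mxrank_unit hu).
by apply: leq_trans (rank_rowsub _ _) _; rewrite mxrank_tr rank_rowsub.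
Qed.

Lemma card_rank_drop (F : finFieldType) (m n : nat) (A0 A1 : 'M[F]_(m, n)) :
  (#|[set t : F | \rank (A0 + t *: A1)%R < \rank A0]| <= n)%N.
Proof.
rewrite cardE; apply: (size_rank_drop (A0 := A0) (A1 := A1)); first exact: enum_uniq.
by apply/allP => t; rewrite mem_enum inE.
Qed.

Definition mx_line (F : finFieldType) (D n : nat) (g v : {ffun 'I_D -> 'M[F]_n}) (t : F) :
  {ffun 'I_D -> 'M[F]_n} := [ffun i => g i + t *: v i].

(** For each fixed [t != 0] the map from [v] to [mx_line g v t] is a bijection, so summing over [v]
    counts [bad] exactly; exchange this sum with the one over [t]. *)
Lemma card_bad_on_lines (F : finFieldType) (D n d : nat)
    (bad : {set {ffun 'I_D -> 'M[F]_n}}) (g : {ffun 'I_D -> 'M[F]_n}) :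
  (forall v, #|[set t | mx_line g v t \in bad]| <= d)%N ->
  (#|F|.-1 * #|bad| <= d * #|{: {ffun 'I_D -> 'M[F]_n}}|)%N.
Proof.
move=> hb.
have Lbij t : t != 0 -> (\sum_v (mx_line g v t \in bad : nat))%N = #|bad|.
  move=> t0; have inj : injective (fun v => mx_line g v t).
    move=> v w /ffunP e; apply/ffunP => i; have := e i; rewrite !ffunE.
    by move/addrI/(scalerI t0).
  rewrite -(card_preimset bad inj) -sum1_card [RHS]big_mkcond.
  by apply: eq_bigr => v _; rewrite inE; case: (_ \in _).
have -> : (#|F|.-1 * #|bad| = \sum_(t : F | t != 0%R) \sum_v (mx_line g v t \in bad : nat))%N.
  rewrite (eq_bigr (fun=> #|bad|)) // sum_nat_const; congr (_ * _)%N.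
  by rewrite -(cardC1 (0 : F)); apply: eq_card => t; rewrite !inE.
rewrite exchange_big /= mulnC -sum_nat_const; apply: leq_sum => v _.
apply: leq_trans (hb v); rewrite -sum1_card big_mkcond [leqRHS]big_mkcond /=.
by apply: leq_sum => t _; rewrite inE; case: (t != 0); case: (_ \in _).
Qed.

(** * Exactness on a set of points *)

Notation grid D n := {ffun 'I_D -> 'I_n}.
Notation tensor F D n := {ffun grid D n -> F}.

Lemma set_coord_eq (D n : nat) (v : grid D n) (i : 'I_D) (a : 'I_n) :
  set_coord v i a i = a.
Proof. by rewrite ffunE eqxx. Qed.

Lemma set_coord_neq (D n : nat) (v : grid D n) (i j : 'I_D) (a : 'I_n) :
  j != i -> set_coord v i a j = v j.
Proof. by rewrite ffunE => /negbTE ->. Qed.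

Lemma set_coordK (D n : nat) (v : grid D n) (i : 'I_D) (a b : 'I_n) :
  set_coord (set_coord v i a) i b = set_coord v i b.
Proof. by apply/ffunP => j; rewrite !ffunE; case: (j == i). Qed.

Lemma set_coord_id (D n : nat) (v : grid D n) (i : 'I_D) : set_coord v i (v i) = v.
Proof. by apply/ffunP => j; rewrite !ffunE; case: eqP => [->|]. Qed.

Lemma set_coord_comm (D n : nat) (v : grid D n) (i j : 'I_D) (a b : 'I_n) :
  i != j -> set_coord (set_coord v i a) j b = set_coord (set_coord v j b) i a.
Proof.
move=> ij; apply/ffunP => l; rewrite !ffunE.
by case: (eqVneq l j) => // ->; rewrite eq_sym (negbTE ij).
Qed.

Definition fullline (D n : nat) (U : {set grid D n}) (i : 'I_D) (v : grid D n) : bool :=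
  [forall a, set_coord v i a \in U].

Lemma fulllineP (D n : nat) (U : {set grid D n}) (i : 'I_D) (v : grid D n) :
  reflect (forall a, set_coord v i a \in U) (fullline U i v).
Proof. exact: forallP. Qed.

Lemma fullline_set_coord (D n : nat) (U : {set grid D n}) (i : 'I_D) (v : grid D n) (a : 'I_n) :
  fullline U i (set_coord v i a) = fullline U i v.
Proof. by apply: eq_forallb => b; rewrite set_coordK. Qed.

Lemma fullline_in (D n : nat) (U : {set grid D n}) (i : 'I_D) (v : grid D n) :
  fullline U i v -> v \in U.
Proof. by move/fulllineP/(_ (v i)); rewrite set_coord_id. Qed.

Definition line_closed (D n s : nat) (U : {set grid D n}) : Prop :=
  forall i v, ~~ fullline U i v -> (#|[set a | set_coord v i a \in U]| <= s)%N.

Definition tcode (F : finFieldType) (D n : nat) (i : 'I_D) (M : 'M[F]_n) (x : tensor F D n) : Prop :=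
  forall g, (restr x i g <= M)%MS.

Definition exact (F : finFieldType) (D n : nat) (M : 'I_D -> 'M[F]_n) (U : {set grid D n}) : Prop :=
  forall a : 'I_D -> tensor F D n, (forall i, tcode i (M i) (a i)) ->
    (forall v, (\sum_i a i) v != 0 -> v \in U) ->
  exists a' : 'I_D -> tensor F D n, [/\ forall i, tcode i (M i) (a' i),
    forall i v, a' i v != 0 -> fullline U i v & \sum_i a i = \sum_i a' i].

Section Generators.
Variables (F : finFieldType) (D n : nat).
Implicit Types (M : 'I_D -> 'M[F]_n) (P : 'I_D -> grid D n -> bool) (U : {set grid D n}).

Definition vec (x : tensor F D n) : 'rV[F]_#|grid D n| := \row_c x (enum_val c).

(* Row (i, w, j) is the j-th row of M i placed on the i-line through w. Every
   line is listed n times, once for each of its points w. *)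
Definition gen M P : 'M[F]_(#|{: 'I_D * grid D n * 'I_n}|, #|grid D n|) :=
  \matrix_(r, c) let: (i, w, j) := enum_val r in
    if P i w && (w == set_coord (enum_val c) i (w i)) then M i j (enum_val c i) else 0.

Lemma vec_sum (I : Type) (r : seq I) (p : pred I) (x : I -> tensor F D n) :
  vec (\sum_(k <- r | p k) x k) = \sum_(k <- r | p k) vec (x k).
Proof.
apply/rowP => c; rewrite !mxE sum_ffunE summxE.
by apply: eq_bigr => k _; rewrite mxE.
Qed.

Lemma vec_inj : injective vec.
Proof.
move=> x y /rowP e; apply/ffunP => v.
by have := e (enum_rank v); rewrite !mxE enum_rankK.
Qed.

Lemma sub_genP M P (c : tensor F D n) : (vec c <= gen M P)%MS ->
  (forall i v a, P i (set_coord v i a) = P i v) ->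
  exists a : 'I_D -> tensor F D n, [/\ forall i, tcode i (M i) (a i),
    forall i v, a i v != 0 -> P i v & c = \sum_i a i].
Proof.
move=> /submxP[u eu] hP.
pose t i (w v : grid D n) (j : 'I_n) : F :=
  u 0 (enum_rank (i, w, j)) *
    (if P i w && (w == set_coord v i (w i)) then M i j (v i) else 0).
exists (fun i => [ffun v => \sum_w \sum_j t i w v j]); split.
- move=> i g.
  have -> : restr [ffun v => \sum_w \sum_j t i w v j] i g =
     \sum_w \sum_j (u 0 (enum_rank (i, w, j)) *+ (P i w && (w == set_coord g i (w i))))
        *: row j (M i).
    apply/rowP => b; rewrite !mxE ffunE summxE; apply: eq_bigr => w _.
    rewrite summxE; apply: eq_bigr => j _; rewrite !mxE /t set_coordK set_coord_eq.
    by case: (_ && _); rewrite ?mulr1n // mulr0n mul0r mulr0.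
  apply: summx_sub => w _; apply: summx_sub => j _.
  by rewrite scalemx_sub // row_sub.
- move=> i v; rewrite ffunE; apply: contraR => nP; apply/eqP.
  rewrite big1 // => w _; rewrite big1 // => j _; rewrite /t.
  case: ifP => [/andP[Pw /eqP ew]|_]; last by rewrite mulr0.
  by move: Pw; rewrite ew hP (negbTE nP).
- apply: vec_inj; rewrite eu; apply/rowP => c0; rewrite !mxE sum_ffunE.
  transitivity (\sum_i \sum_w \sum_j t i w (enum_val c0) j).
    rewrite pair_bigA /= pair_bigA /= (reindex enum_rank) /=; last first.
      by apply: onW_bij; exact: enum_rank_bij.
    by apply: eq_bigr => -[[i w] j] _; rewrite mxE enum_rankK.
  by apply: eq_bigr => i _; rewrite ffunE.
Qed.

Lemma tcode_sub_gen M P i (x : tensor F D n) : tcode i (M i) x ->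
  (forall v a, P i (set_coord v i a) = P i v) ->
  (forall v, x v != 0 -> P i v) -> (vec x <= gen M P)%MS.
Proof.
move=> hx hP xP.
case: (pickP (fun v => x v != 0)) => [v0 _|x0]; last first.
  suff -> : vec x = 0 by exact: sub0mx.
  by apply/rowP => c; rewrite !mxE; apply/eqP; have := x0 (enum_val c); move/negbFE.
(* The generators with [w i == z] list every i-line exactly once. *)
pose z := v0 i.
pose lam w := restr x i w *m pinvmx (M i).
have elam w : lam w *m M i = restr x i w by rewrite mulmxKpV.
have -> : vec x = \sum_(w : grid D n | w i == z) \sum_j (lam w 0 j *+ P i w) *:
     row (enum_rank (i, w, j)) (gen M P).
  apply/rowP => c; rewrite !mxE; set v := enum_val c.
  rewrite summxE (bigD1 (set_coord v i z)) /= ?set_coord_eq // [X in _ + X]big1 ?addr0; last first.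
    move=> w /andP[/eqP wz nw]; rewrite summxE big1 // => j _.
    by rewrite !mxE enum_rankK wz -/v (negbTE nw) andbF mulr0.
  rewrite summxE.
  have [Pv|nPv] := boolP (P i v); last first.
    rewrite big1; first by apply/eqP; apply: contraR nPv => /xP.
    by move=> j _; rewrite hP (negbTE nPv) mulr0n scale0r mxE.
  transitivity ((lam (set_coord v i z) *m M i) 0 (v i)).
    by rewrite elam mxE set_coordK set_coord_id.
  rewrite mxE; apply: eq_bigr => j _; rewrite !mxE enum_rankK hP Pv mulr1n -/v.
  by rewrite set_coord_eq eqxx.
apply: summx_sub => w _; apply: summx_sub => j _.
by rewrite scalemx_sub // row_sub.
Qed.

Definition supp_mx U : 'M[F]_#|grid D n| :=
  \matrix_(r, c) ((r == c) && (enum_val c \in U))%:R.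

Lemma sub_supp_mx U (x : tensor F D n) :
  reflect (forall v, x v != 0 -> v \in U) (vec x <= supp_mx U)%MS.
Proof.
apply: (iffP idP) => [/submxP[u eu] v|hx].
  have -> : x v = (vec x) 0 (enum_rank v) by rewrite mxE enum_rankK.
  rewrite eu mxE; apply: contraR => vU; apply/eqP; rewrite big1 // => r _.
  by rewrite mxE enum_rankK (negbTE vU) andbF mulr0.
suff -> : vec x = vec x *m supp_mx U by exact: submxMl.
apply/rowP => c; rewrite !mxE (bigD1 c) //= !mxE eqxx /= big1 ?addr0; last first.
  by move=> r /negbTE rc; rewrite !mxE rc mulr0.
have [|/negPf nU] := boolP (enum_val c \in U); first by rewrite mulr1.
by rewrite mulr0; apply/eqP; apply: contraFT nU; exact: hx.
Qed.

Lemma vecK (u : 'rV[F]_#|grid D n|) : vec [ffun v => u 0 (enum_rank v)] = u.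
Proof. by apply/rowP => c; rewrite mxE ffunE enum_valK. Qed.

Definition box M := gen M (fun _ _ => true).
Definition box_in M U := gen M (fullline U).

(** As an inclusion of row spaces, exactness can be tested by comparing ranks. *)
Lemma exact_subP M U :
  exact M U <-> (box M :&: supp_mx U <= box_in M U)%MS.
Proof.
split=> [ex|hs a ha hU].
  apply/rV_subP => u; rewrite sub_capmx -(vecK u) => /andP[/sub_genP h /sub_supp_mx hU].
  have [//|a [ha _ ec]] := h.
  rewrite ec in hU *; have [a' [ha' hf ->]] := ex a ha hU.
  rewrite vec_sum; apply: summx_sub => i _; apply: tcode_sub_gen (ha' i) _ _.
    by move=> v b; rewrite fullline_set_coord.
  exact: hf.
have /sub_genP : (vec (\sum_i a i)%R <= box_in M U)%MS.
  apply: submx_trans hs; rewrite sub_capmx; apply/andP; split; last exact/sub_supp_mx.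
  by rewrite vec_sum; apply: summx_sub => i _; exact: tcode_sub_gen (ha i) _ _.
case=> [i v b|a' [h1 h2 h3]]; first exact: fullline_set_coord.
by exists a'.
Qed.

Lemma box_in_sub M U : (box_in M U <= box M :&: supp_mx U)%MS.
Proof.
rewrite sub_capmx; apply/andP; split; apply/row_subP => r.
  case E : (enum_val r) => [[i w] j].
  have [f|nf] := boolP (fullline U i w).
    suff -> : row r (box_in M U) = row r (box M) by exact: row_sub.
    by apply/rowP => c; rewrite !mxE E f.
  suff -> : row r (box_in M U) = 0 by exact: sub0mx.
  by apply/rowP => c; rewrite !mxE E (negbTE nf).
rewrite -[row r _]vecK; apply/sub_supp_mx => v; rewrite !ffunE !mxE.
case E : (enum_val r) => [[i w] j]; rewrite enum_rankK.
case: ifP => [/andP[f /eqP ew] _|]; last by rewrite eqxx.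
by apply: (@fullline_in _ _ _ i); rewrite -(fullline_set_coord _ _ _ (w i)) -ew.
Qed.

(* Exactness says that rank (box_in M U) equals the dimension of the words of the
   box-sum supported on U, which is rank box + |U| - rank (box + supp_mx U). *)
Lemma exact_by_rank M M0 U : exact M0 U ->
  (\rank (box M) <= \rank (box M0))%N -> (\rank (box_in M0 U) <= \rank (box_in M U))%N ->
  (\rank (col_mx (box M0) (supp_mx U)) <= \rank (col_mx (box M) (supp_mx U)))%N ->
  exact M U.
Proof.
move=> /exact_subP ex0 r1 r2 r3; apply/exact_subP.
rewrite -(mxrank_leqif_sup (box_in_sub M U)) eqn_leq mxrankS ?box_in_sub //=.
apply: leq_trans r2; apply: leq_trans (mxrankS ex0).
have := mxrank_sum_cap (box M) (supp_mx U).
have := mxrank_sum_cap (box M0) (supp_mx U).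
move: r3; rewrite -!addsmxE; lia.
Qed.

End Generators.

(** * Genericity of exactness *)

Section Genericity.
Variables (F : finFieldType) (D n : nat).
Implicit Types (M g h : 'I_D -> 'M[F]_n) (U : {set grid D n}).

Definition exactb M U : bool := (box M :&: supp_mx F U <= box_in M U)%MS.

Lemma exactP M U : reflect (exact M U) (exactb M U).
Proof. by apply: (iffP idP) => /exact_subP. Qed.

(* The automorphism of F^([n]^D) that carries the box-sum of the codes M i into
   that of the codes M i *m g i; it shows that the dimension is constant. *)
Definition kron g : 'M[F]_#|grid D n| :=
  \matrix_(r, c) \prod_i g i ((enum_val r : grid D n) i) ((enum_val c : grid D n) i).

Lemma kronM g h : kron g *m kron h = kron (fun i => g i *m h i).
Proof.
apply/matrixP => r c; rewrite !mxE.
under [RHS]eq_bigr do rewrite mxE.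
rewrite bigA_distr_bigA (reindex enum_rank) /=; last first.
  by apply: onW_bij; exact: enum_rank_bij.
apply: eq_bigr => u _; rewrite !mxE enum_rankK -big_split.
by apply: eq_bigr => i _.
Qed.

Lemma kron1 : kron (fun=> 1%:M) = 1%:M.
Proof.
apply/matrixP => r c; rewrite !mxE.
have [->|rc] := eqVneq r c; first by rewrite big1 // => i _; rewrite mxE eqxx.
have /existsP[i hi] : [exists i, (enum_val r : grid D n) i != (enum_val c : grid D n) i].
  rewrite -negb_forall; apply: contra rc => /forallP h.
  by apply/eqP/enum_val_inj/ffunP => i; exact/eqP.
by rewrite (bigD1 i) //= mxE (negbTE hi) mul0r.
Qed.

Lemma kron_unit g : (forall i, g i \in unitmx) -> kron g \in unitmx.
Proof.
move=> hg; suff /mulmx1_unit[] : kron g *m kron (fun i => invmx (g i)) = 1%:M by [].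
rewrite kronM -kron1; apply/matrixP => r c; rewrite !mxE.
by apply: eq_bigr => i _; rewrite mulmxV.
Qed.

Lemma sum_line (w : grid D n) i (f : grid D n -> F) :
  \sum_(u : grid D n | w == set_coord u i (w i)) f u = \sum_a f (set_coord w i a).
Proof.
rewrite (reindex_onto (fun a => set_coord w i a) (fun u => u i)) /=.
  by apply: eq_bigl => a; rewrite set_coordK set_coord_id set_coord_eq !eqxx.
by move=> u /eqP ->; rewrite set_coordK set_coord_id.
Qed.

(** A generator is a row of [M i] placed on one i-line. The Kronecker product spreads it over the
    grid, and every i-line of the image carries a multiple of that row times [g i]. *)
Lemma box_kron M g : (box M *m kron g <= box (fun i => (M i *m g i)%R))%MS.
Proof.
apply/row_subP => r; case E : (enum_val r) => [[i w] j].
pose x : tensor F D n := [ffun v : grid D n => \sum_(u : grid D n | w == set_coord u i (w i))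
   M i j (u i) * \prod_l g l (u l) (v l)].
have -> : row r (box M *m kron g) = vec x.
  apply/rowP => c; rewrite !mxE ffunE [RHS]big_mkcond.
  rewrite (reindex enum_rank) /=; last by apply: onW_bij; exact: enum_rank_bij.
  by apply: eq_bigr => u _; rewrite !mxE E enum_rankK /=; case: ifP; rewrite ?mul0r.
apply: (@tcode_sub_gen _ _ _ _ _ i) => // h.
have -> : restr x i h = (\prod_(l | l != i) g l (w l) (h l)) *: row j (M i *m g i).
  apply/rowP => b; rewrite !mxE ffunE sum_line mulr_sumr.
  apply: eq_bigr => a _; rewrite set_coord_eq (bigD1 i) //= !set_coord_eq.
  rewrite [RHS]mulrC -mulrA; congr (_ * (_ * _)).
  by apply: eq_bigr => l li; rewrite !set_coord_neq.
by rewrite scalemx_sub // row_sub.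
Qed.

Lemma rank_box_mul M g : (forall i, g i \in unitmx) ->
  (\rank (box M) <= \rank (box (fun i => (M i *m g i)%R)))%N.
Proof.
move=> hg; rewrite -(mxrankMfree (box M) (_ : row_free (kron g))).
  exact: mxrankS (box_kron M g).
by rewrite row_free_unit kron_unit.
Qed.

Lemma gen_affine (M0 M1 : 'I_D -> 'M[F]_n) P (t : F) :
  gen (fun i => M0 i + t *: M1 i) P = gen M0 P + t *: gen M1 P.
Proof.
apply/matrixP => r c; rewrite !mxE; case: (enum_val r) => [[i w] j].
by case: ifP => _; rewrite ?mxE ?mulr0 ?addr0.
Qed.

Lemma eq_gen (M0 M1 : 'I_D -> 'M[F]_n) P : M0 =1 M1 -> gen M0 P = gen M1 P.
Proof.
move=> e; apply/matrixP => r c; rewrite !mxE; case: (enum_val r) => [[i w] j].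
by rewrite e.
Qed.

Lemma eq_exact (M0 M1 : 'I_D -> 'M[F]_n) U : M0 =1 M1 -> exact M0 U -> exact M1 U.
Proof. by move=> e /exactP h; apply/exactP; rewrite /exactb /box /box_in -!(eq_gen _ e). Qed.

(** Invertible matrices parametrise the codes of dimension [k i <= n] through the span of their
    first [k i] rows. *)
Definition code (k : 'I_D -> nat) g : 'I_D -> 'M[F]_n := fun i => pid_mx (k i) *m g i.

(** Along a line through [g0], each of the two ranks needed in [exact_by_rank] drops for at most
    [n ^ D] values of [t], the number of columns. The rank of the box-sum is the same for all
    invertible tuples. Where neither rank drops, exactness is inherited from [g0]. *)
Lemma card_not_exact (k : 'I_D -> nat) U (g0 : {ffun 'I_D -> 'M[F]_n}) :
  (forall i, g0 i \in unitmx) -> exact (code k g0) U ->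
  (#|F|.-1 * #|[set g : {ffun 'I_D -> 'M[F]_n} |
       [forall i, g i \in unitmx] && ~~ exactb (code k g) U]|
    <= (2 * n ^ D) * #|{: {ffun 'I_D -> 'M[F]_n}}|)%N.
Proof.
move=> ug0 ex0; apply: (card_bad_on_lines (g := g0)) => v.
pose A0 := box_in (code k g0) U; pose A1 := box_in (code k v) U.
pose B0 := col_mx (box (code k g0)) (supp_mx F U).
(* The support space does not move along the line, hence the zero block. *)
pose B1 : 'M[F]_(_, _) := col_mx (box (code k v)) (0 : 'M_#|grid D n|).
have hline t : code k (mx_line g0 v t) =1 fun i => (code k g0 i + t *: code k v i)%R.
  by move=> i; rewrite /code ffunE mulmxDr -scalemxAr.
have cN : #|grid D n| = (n ^ D)%N by rewrite card_ffun !card_ord.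
apply: leq_trans (_ : (#|[set t | \rank (A0 + t *: A1)%R < \rank A0] :|:
    [set t | \rank (B0 + t *: B1)%R < \rank B0]| <= _)%N); last first.
  apply: leq_trans (leq_card_setU _ _) _; rewrite mul2n -addnn -cN.
  by apply: leq_add; exact: card_rank_drop.
apply: subset_leq_card; apply/subsetP => t; rewrite !inE => /andP[/forallP ug ne].
apply: contraR ne; rewrite negb_or -!leqNgt => /andP[hA hB]; apply/exactP.
apply: (exact_by_rank ex0).
(* Multiplication by [q] carries the codes at [t] to those of [g0], which compares the dimensions of
   the box-sums. *)
- pose q i := invmx (mx_line g0 v t i) *m g0 i.
  have uq i : q i \in unitmx by rewrite unitmx_mul unitmx_inv ug ug0.
  apply: leq_trans (rank_box_mul _ uq) _.
  rewrite /box (@eq_gen _ (code k g0)) // => i.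
  by rewrite /code /q -mulmxA mulKVmx.
- by rewrite /box_in (eq_gen _ (hline t)) gen_affine.
- rewrite /box (eq_gen _ (hline t)) gen_affine.
  by move: hB; rewrite /B0 /B1 scale_col_mx add_col_mx scaler0 addr0.
Qed.

Lemma card_not_unit :
  (#|F|.-1 * #|[set g : {ffun 'I_D -> 'M[F]_n} | ~~ [forall i, g i \in unitmx]]|
    <= (D * n) * #|{: {ffun 'I_D -> 'M[F]_n}}|)%N.
Proof.
apply: (card_bad_on_lines (g := [ffun=> 1%:M])) => v.
apply: leq_trans (_ : (#|\bigcup_(i : 'I_D)
   [set t : F | \rank (1%:M + t *: v i)%R < \rank (1%:M : 'M[F]_n)]| <= _)%N).
  apply: subset_leq_card; apply/subsetP => t; rewrite !inE negb_forall.
  case/existsP => i; rewrite !ffunE => hi; apply/bigcupP; exists i => //.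
  rewrite inE mxrank1 ltn_neqAle rank_leq_row andbT.
  by apply: contra hi; rewrite -row_free_unit.
apply: leq_trans (card_bigcup_le _) _.
apply: leq_trans (leq_sum _ (fun i _ => card_rank_drop _ _)) _.
by rewrite sum_nat_const card_ord.
Qed.

End Genericity.

(** * Cells *)

(** [th] sends a coordinate to the label of its block and its position there. A position that no
    coordinate fills reads 0. *)
Definition block_part (F : fieldType) (n n' : nat) (Lab : finType)
    (th : 'I_n -> Lab * 'I_n') (l : Lab) (c : 'rV[F]_n) : 'rV[F]_n' :=
  \row_x \sum_(a | th a == (l, x)) c 0 a.

Section Cells.
Variables (F : finFieldType) (D n n' : nat) (Lab : finType).
Variable th : 'I_D -> 'I_n -> Lab * 'I_n'.
Hypothesis th_inj : forall i, injective (th i).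
Implicit Types (v : grid D n) (w : grid D n') (b : {ffun 'I_D -> Lab}).

Definition cell v : {ffun 'I_D -> Lab} := [ffun i => (th i (v i)).1].
Definition cell_pos v : grid D n' := [ffun i => (th i (v i)).2].

Lemma cell_pos_inj v v' : cell v = cell v' -> cell_pos v = cell_pos v' -> v = v'.
Proof.
move=> /ffunP e1 /ffunP e2; apply/ffunP => i; apply: (@th_inj i).
have := e1 i; have := e2 i; rewrite !ffunE.
by case: (th i (v i)) => x y; case: (th i (v' i)) => x' y' /= -> ->.
Qed.

Definition in_cell (b : {ffun 'I_D -> Lab}) (U : {set grid D n}) : {set grid D n'} :=
  [set w | [exists v in U, (cell v == b) && (cell_pos v == w)]].

Lemma in_cellP b (U : {set grid D n}) w :
  reflect (exists v, [/\ v \in U, cell v = b & cell_pos v = w]) (w \in in_cell b U).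
Proof.
rewrite inE; apply: (iffP existsP) => -[v].
  by case/and3P => vU /eqP ? /eqP ?; exists v.
by case=> vU e1 e2; exists v; rewrite vU e1 e2 !eqxx.
Qed.

Lemma cell_pos_in v (U : {set grid D n}) : (cell_pos v \in in_cell (cell v) U) = (v \in U).
Proof.
apply/in_cellP/idP => [[v' [v'U e1 e2]]|vU]; last by exists v.
by rewrite -(cell_pos_inj e1 e2).
Qed.

(** The sum has at most one term, because cell and position determine the point; unfilled positions
    get 0. *)
Definition pull b (x : tensor F D n) : tensor F D n' :=
  [ffun w => \sum_(v : grid D n | (cell v == b) && (cell_pos v == w)) x v].

Lemma pull_sum b (I : finType) (x : I -> tensor F D n) :
  pull b (\sum_k x k) = \sum_k pull b (x k).
Proof.
apply/ffunP => w; rewrite ffunE sum_ffunE; under eq_bigr do rewrite sum_ffunE.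
by rewrite exchange_big; apply: eq_bigr => k _; rewrite ffunE.
Qed.

Lemma pull_cell_pos v (x : tensor F D n) : pull (cell v) x (cell_pos v) = x v.
Proof.
rewrite ffunE (bigD1 v) ?eqxx //= big1 ?addr0 // => v'.
case/andP=> /andP[/eqP e1 /eqP e2] /eqP[]; exact: cell_pos_inj.
Qed.

Variables (M : 'I_D -> 'M[F]_n) (G : 'I_D -> Lab -> 'M[F]_n').
Hypothesis MG : forall i (c : 'rV[F]_n),
  (c <= M i)%MS <-> forall l, (block_part (th i) l c <= G i l)%MS.

Lemma tcode_pull i b (x : tensor F D n) :
  tcode i (M i) x -> tcode i (G i (b i)) (pull b x).
Proof.
move=> hx w.
(* The given line of the cell either comes from the grid line through some [v0], or no grid point
   lies over it and the pulled word is 0 there. *)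
case: (pickP (fun v => [forall j, (j != i) ==> (th j (v j) == (b j, w j))])) => [v0|no].
  move=> /forallP h0; have {}h0 j : j != i -> th j (v0 j) = (b j, w j).
    by move=> ji; apply/eqP/(implyP (h0 j)).
  suff -> : restr (pull b x) i w = block_part (th i) (b i) (restr x i v0) by have /MG := hx v0.
  apply/rowP => y; rewrite !mxE ffunE; under [RHS]eq_bigr do rewrite mxE.
  rewrite (reindex_onto (fun a => set_coord v0 i a) (fun v => v i)) /=; last first.
    move=> v /andP[/eqP/ffunP e1 /eqP/ffunP e2]; apply/ffunP => j; rewrite ffunE.
    case: eqP => [->//|/eqP ji]; apply: (@th_inj j); rewrite h0 //.
    have := e1 j; have := e2 j; rewrite !ffunE (negbTE ji).
    by case: (th j (v j)) => ? ? /= -> ->.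
  apply: eq_bigl => a; rewrite set_coord_eq eqxx andbT.
  apply/andP/eqP => [[/eqP/ffunP/(_ i) + /eqP/ffunP/(_ i)]|e].
    by rewrite !ffunE eqxx; case: (th i a) => ? ? /= -> ->.
  split; apply/eqP/ffunP => j; rewrite !ffunE; have [->|ji] := eqVneq j i; rewrite ?e //;
    by rewrite h0.
suff -> : restr (pull b x) i w = 0 by exact: sub0mx.
apply/rowP => y; rewrite !mxE ffunE big1 // => v /andP[/eqP e1 /eqP e2].
have /negP[] := negbT (no v); apply/forallP => j; apply/implyP => ji.
have := congr1 (fun f : grid D n' => f j) e2; rewrite !ffunE (negbTE ji) => <-.
by rewrite -e1 ffunE -surjective_pairing.
Qed.

(** The pulled word is decomposed in each cell separately, and the pieces are put back together.
    Each piece lives on full lines of its cell, which lie on full lines of [U] by the second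
    hypothesis. *)
Lemma exact_cells (U : {set grid D n}) :
  (forall b, exact (fun i => G i (b i)) (in_cell b U)) ->
  (forall v i, v \in U -> fullline (in_cell (cell v) U) i (cell_pos v) -> fullline U i v) ->
  exact M U.
Proof.
move=> hex hfull a ha hU.
have hb b : exists a' : 'I_D -> tensor F D n', [/\ forall i, tcode i (G i (b i)) (a' i),
    forall i w, a' i w != 0 -> fullline (in_cell b U) i w & pull b (\sum_i a i) = \sum_i a' i].
  rewrite pull_sum; apply: hex => [i|w]; first exact: tcode_pull.
  rewrite -pull_sum ffunE; apply: contraR => /in_cellP wU; apply/eqP.
  apply: big1 => v /andP[/eqP e1 /eqP e2]; apply/eqP; apply: contra_notT wU => /hU vU.
  by exists v.
have {hb}[A hA] := fin_all_exists hb.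
exists (fun i => [ffun v => A (cell v) i (cell_pos v)]).
have hfl i v : A (cell v) i (cell_pos v) != 0 -> fullline U i v.
  have [_ h _] := hA (cell v); move=> /h f; apply: hfull => //.
  by rewrite -cell_pos_in; exact: fullline_in f.
split=> [i g|i v|]; last 1 first.
- apply/ffunP => v; rewrite -[LHS]pull_cell_pos; have [_ _ ->] := hA (cell v).
  by rewrite !sum_ffunE; apply: eq_bigr => i _; rewrite ffunE.
- apply/MG => l; pose b := [ffun j => if j == i then l else cell g j].
  have [hc hf _] := hA b.
  have cellb y : (th i y).1 = l -> cell (set_coord g i y) = b.
    by move=> ey; apply/ffunP => j; rewrite !ffunE; case: eqVneq => // ->.
  have posb y : cell_pos (set_coord g i y) = set_coord (cell_pos g) i (th i y).2.
    by apply/ffunP => j; rewrite !ffunE; case: eqVneq => // ->.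
  suff -> : block_part (th i) l (restr [ffun v => A (cell v) i (cell_pos v)] i g) =
      restr (A b i) i (cell_pos g).
    by have := hc i (cell_pos g); rewrite ffunE eqxx.
  apply/rowP => x; rewrite !mxE; under eq_bigr do rewrite mxE ffunE.
  case: (pickP (fun y => th i y == (l, x))) => [y0 /eqP ey|no].
    rewrite (bigD1 y0) ?ey ?eqxx //= big1 ?addr0 ?cellb ?posb ?ey //.
    by move=> y' /andP[/eqP ey' /eqP[]]; apply: (@th_inj i); rewrite ey' ey.
  (* A position filled by no coordinate is not in [in_cell b U], so [A b i] must vanish there. *)
  rewrite big_pred0 //; apply/esym/eqP/negPn/negP => /hf /fullline_in.
  case/in_cellP => v [_ /ffunP/(_ i) e1 /ffunP/(_ i) e2].
  have /negP[] := negbT (no (v i)); move: e1 e2; rewrite !ffunE !eqxx.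
  by case: (th i (v i)) => ? ? /= -> ->.
- by rewrite ffunE; exact: hfl.
Qed.

End Cells.

(** * Exactness when few coordinates are thin *)

(** The words supported on [Q] meet the code trivially, so the code has a complement [Y] containing
    them; project onto [Y] along the code. *)
Lemma projection_fixing (F : fieldType) (n : nat) (M : 'M[F]_n) (Q : {set 'I_n}) :
  (forall c : 'rV[F]_n, (c <= M)%MS -> (forall a, c 0 a != 0 -> a \in Q) -> c = 0) ->
  exists Pr : 'M[F]_n, [/\ forall c : 'rV_n, (c <= M)%MS -> c *m Pr = 0,
    forall c : 'rV_n, (c - c *m Pr <= M)%MS &
    forall c : 'rV_n, (forall a, c 0 a != 0 -> a \in Q) -> c *m Pr = c].
Proof.
move=> hM; pose K : 'M[F]_n := \matrix_(r, c) ((r == c) && (r \in Q))%:R.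
have KP (c : 'rV[F]_n) : (c <= K)%MS <-> (forall a, c 0 a != 0 -> a \in Q).
  have e (u : 'rV[F]_n) a : (u *m K) 0 a = u 0 a *+ (a \in Q).
    rewrite mxE (bigD1 a) //= mxE eqxx big1 ?addr0; last first.
      by move=> b /negbTE ba; rewrite mxE ba mulr0.
    by rewrite mulr_natr.
  split=> [/submxP[u ->] a|h].
    by rewrite e; case: (a \in Q) => //; rewrite mulr0n eqxx.
  suff -> : c = c *m K by exact: submxMl.
  apply/rowP => a; rewrite e; case aQ : (a \in Q) => //.
  by rewrite mulr0n; apply/eqP; apply: contraFT aQ; exact: h.
pose Y := (K + (M + K)^C)%MS.
have dir : (Y :&: M = 0)%MS.
  apply/eqP; rewrite -submx0; apply/rV_subP => v; rewrite sub_capmx => /andP[/sub_addsmxP].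
  case=> -[u1 u2] /= ev vM.
  have w0 : u2 *m (M + K)^C%MS = 0.
    apply/eqP; rewrite -submx0 -(capmx_compl (M + K)%MS) sub_capmx submxMl andbT.
    have -> : u2 *m ((M + K)^C)%MS = v - u1 *m K by rewrite ev addrC addKr.
    apply: addmx_sub; first exact: submx_trans vM (addsmxSl _ _).
    by rewrite eqmx_opp; exact: submx_trans (submxMl _ _) (addsmxSr _ _).
  rewrite submx0; apply/eqP; apply: hM => //; apply/KP.
  by rewrite ev w0 addr0 submxMl.
exists (proj_mx Y M); split=> c.
- by move=> cM; rewrite proj_mx_0.
- apply: proj_mx_compl_sub; apply: submx_full; rewrite /row_full eqn_leq rank_leq_col /=.
  have : (1%:M <= (M + K) + (M + K)^C)%MS by rewrite submx_full // addsmx_compl_full.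
  move/mxrankS; rewrite mxrank1 => h; apply: leq_trans h _; apply: mxrankS.
  rewrite !addsmx_sub addsmxSr /= (submx_trans (addsmxSl K (M + K)^C%MS)) ?addsmxSl //.
  by rewrite (submx_trans (addsmxSr K (M + K)^C%MS)) ?addsmxSl.
- by move=> /KP cK; rewrite proj_mx_id // (submx_trans cK) // addsmxSl.
Qed.

Section FewCoordinates.
Variables (F : finFieldType) (D n : nat).

Definition axis_act (i : 'I_D) (Pr : 'M[F]_n) (x : tensor F D n) : tensor F D n :=
  [ffun v : grid D n => \sum_a x (set_coord v i a) * Pr a (v i)].

Lemma restr_axis_act i Pr (x : tensor F D n) g :
  restr (axis_act i Pr x) i g = restr x i g *m Pr.
Proof.
apply/rowP => b; rewrite !mxE ffunE; apply: eq_bigr => a _.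
by rewrite mxE set_coordK set_coord_eq.
Qed.

Lemma tcode_axis_act i j Pr (M : 'M[F]_n) (x : tensor F D n) :
  j != i -> tcode j M x -> tcode j M (axis_act i Pr x).
Proof.
move=> ji hx g.
have -> : restr (axis_act i Pr x) j g = \sum_a Pr a (g i) *: restr x j (set_coord g i a).
  apply/rowP => b; rewrite !mxE ffunE summxE; apply: eq_bigr => a _.
  by rewrite !mxE set_coord_neq 1?eq_sym // mulrC set_coord_comm.
by apply: summx_sub => a _; rewrite scalemx_sub.
Qed.

Lemma axis_act_sum i Pr (I : finType) (x : I -> tensor F D n) :
  axis_act i Pr (\sum_k x k) = \sum_k axis_act i Pr (x k).
Proof.
apply/ffunP => v; rewrite ffunE sum_ffunE.
under eq_bigr do rewrite sum_ffunE mulr_suml.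
by rewrite exchange_big; apply: eq_bigr => k _; rewrite ffunE.
Qed.

Definition thin_coords (U : {set grid D n}) (i : 'I_D) : {set 'I_n} :=
  [set a | [exists v in U, (v i == a) && ~~ fullline U i v]].

Lemma thin_coordsP (U : {set grid D n}) i v :
  v \in U -> ~~ fullline U i v -> v i \in thin_coords U i.
Proof. by move=> vU nf; rewrite inE; apply/existsP; exists v; rewrite vU eqxx. Qed.

Lemma exact_thin (M : 'I_D -> 'M[F]_n) (U : {set grid D n}) :
  (forall i (c : 'rV[F]_n), (c <= M i)%MS ->
     (forall a, c 0 a != 0 -> a \in thin_coords U i) -> c = 0) ->
  exact M U.
Proof.
move=> hM.
have [Pr hPr] := fin_all_exists (fun i => projection_fixing (hM i)).
suff main (r : seq 'I_D) (a : 'I_D -> tensor F D n) : (forall i, tcode i (M i) (a i)) ->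
    (forall i, i \notin r -> a i = 0) -> (forall v, (\sum_i a i) v != 0 -> v \in U) ->
    exists a' : 'I_D -> tensor F D n, [/\ forall i, tcode i (M i) (a' i),
      forall i v, a' i v != 0 -> fullline U i v & \sum_i a i = \sum_i a' i].
  by move=> a ha; apply: (main (enum 'I_D)) => // i; rewrite mem_enum.
(* Telescoping: replace c by its image x under the projection along the code of
   direction i; c - x is a codeword of that direction living on full lines. *)
elim: r a => [|i r IH] a ha hr hU.
  exists a; split=> // i v; rewrite hr ?ffunE ?eqxx //.
have [kill compl fix_] := hPr i.
set c := \sum_i a i in hU *; pose x := axis_act i (Pr i) c.
(* On a line that is not full, [c] is supported on the thin coordinates, where the projection is the
   identity. Hence [x] is still supported on [U], and [c - x] vanishes off the full lines. *)
have out v b : ~~ fullline U i v -> restr c i v 0 b != 0 -> b \in thin_coords U i.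
  rewrite mxE => nf /hU vU; rewrite -(set_coord_eq v i b).
  by apply: thin_coordsP; rewrite ?fullline_set_coord.
have xU v : x v != 0 -> v \in U.
  have [f|nf] := boolP (fullline U i v); first by rewrite (fullline_in f).
  have -> : x v = (restr x i v) 0 (v i) by rewrite mxE set_coord_id.
  rewrite restr_axis_act fix_; last by move=> b; exact: out.
  by rewrite mxE set_coord_id; exact: hU.
(* The projection kills [a i] and preserves the codes of the other directions, so [x] is a sum over
   [r] alone. *)
have [|||a' [h1 h2 h3]] := IH (fun j => axis_act i (Pr i) (a j)).
- move=> j; have [->|ji] := eqVneq j i; last exact: tcode_axis_act.
  by move=> g; rewrite restr_axis_act kill ?sub0mx //; exact: ha.
- move=> j jr; have [->|ji] := eqVneq j i.
    apply/ffunP => v; rewrite [RHS]ffunE.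
    transitivity ((restr (axis_act i (Pr i) (a i)) i v) 0 (v i)).
      by rewrite mxE set_coord_id.
    by rewrite restr_axis_act kill ?mxE //; exact: ha.
  rewrite hr ?inE ?negb_or ?ji //; apply/ffunP => v; rewrite !ffunE big1 // => b _.
  by rewrite ffunE mul0r.
- by move=> v; rewrite -axis_act_sum; exact: xU.
have dcode g : (restr (c - x) i g <= M i)%MS.
  have -> : restr (c - x) i g = restr c i g - restr c i g *m Pr i.
    by rewrite -restr_axis_act; apply/rowP => b; rewrite !mxE !ffunE.
  exact: compl.
exists (fun j => a' j + (if j == i then c - x else 0)); split.
- move=> j g.
  have -> : restr (a' j + (if j == i then c - x else 0)) j g =
      restr (a' j) j g + restr (if j == i then c - x else 0) j g.
    by apply/rowP => b; rewrite !mxE !ffunE.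
  apply: addmx_sub; first exact: h1.
  have [->|ji] := eqVneq j i; first exact: dcode.
  suff -> : restr 0 j g = 0 :> 'rV[F]_n by exact: sub0mx.
  by apply/rowP => b; rewrite !mxE ffunE.
- move=> j v; rewrite ffunE; apply: contraR => nf.
  have -> : a' j v = 0 by apply/eqP; apply: contraR nf; exact: h2.
  rewrite add0r; move: nf; have [->|ji] := eqVneq j i => nf; last by rewrite ffunE.
  have -> : (c - x) v = (restr c i v - restr c i v *m Pr i) 0 (v i).
    by rewrite -restr_axis_act !mxE set_coord_id !ffunE.
  by rewrite fix_ ?subrr ?mxE // => b; exact: out.
- rewrite big_split /= -h3 -axis_act_sum -/c -/x (bigD1 i) //= eqxx big1 ?addr0.
    by rewrite addrC subrK.
  by move=> j /negbTE ->.
Qed.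

End FewCoordinates.

(** * Gluing codes along blocks *)

Lemma exact_eqmx (F : finFieldType) (D n : nat) (M0 M1 : 'I_D -> 'M[F]_n) (U : {set grid D n}) :
  (forall i, (M0 i :=: M1 i)%MS) -> exact M0 U -> exact M1 U.
Proof.
move=> e h a ha hU; have [|a' [h1 h2 h3]] := h a _ hU.
  by move=> i g; rewrite e; exact: ha.
by exists a'; split=> // i g; rewrite -e; exact: h1.
Qed.

Lemma pid_row_ebase (F : fieldType) (n : nat) (M : 'M[F]_n) :
  exists2 g : 'M[F]_n, g \in unitmx & ((pid_mx (\rank M) : 'M_n) *m g :=: M)%MS.
Proof.
exists (row_ebase M); first exact: row_ebase_unit.
have full : row_full (col_ebase M) by rewrite row_full_unit col_ebase_unit.
have := eqmxMfull (pid_mx (\rank M) *m row_ebase M) full.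
by rewrite mulmxA mulmx_ebase => e; exact: eqmx_sym.
Qed.

Section Glue.
Variables (F : fieldType) (n n' : nat) (Lab : finType) (th : 'I_n -> Lab * 'I_n').
Variable G : Lab -> 'M[F]_n'.
Hypothesis th_inj : injective th.
Hypothesis hG : forall l, G l = 0 \/ forall x, exists a, th a = (l, x).

Let E l : 'M[F]_(n', n) := \matrix_(x, a) (th a == (l, x))%:R.
(* The code of all c whose part in each block l lies in G l. Blocks that th does
   not fill completely must carry the zero code. *)
Definition glue : 'M[F]_n := (\sum_l <<G l *m E l>>)%MS.

Let GEE l l' : G l *m E l *m (E l')^T = if l == l' then G l' else 0.
Proof.
have [G0 | full] := hG l; first by rewrite G0 !mul0mx; case: eqP => // <-.
suff -> : G l *m E l *m (E l')^T = G l *m (if l == l' then 1%:M else 0).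
  by case: eqP => [->|_]; rewrite ?mulmx1 ?mulmx0.
rewrite -mulmxA; congr (_ *m _); apply/matrixP => x y; rewrite !mxE.
have [a ea] := full x; rewrite (bigD1 a) //= !mxE ea eqxx mul1r big1 ?addr0.
  by rewrite xpair_eqE; case: eqP => // _; rewrite mxE.
move=> b ba; rewrite !mxE; case: eqP => [eb|_]; last by rewrite mul0r.
by case/eqP: ba; apply: th_inj; rewrite ea eb.
Qed.

Let sub_GE l l' (v : 'rV[F]_n) :
  (v <= <<G l *m E l>>)%MS -> (v *m (E l')^T <= if l == l' then G l' else 0)%MS.
Proof. by rewrite genmxE => /(submxMr (E l')^T); rewrite GEE. Qed.

Lemma glue_pull (c : 'rV[F]_n) :
  (c <= glue)%MS <-> forall l, (block_part th l c <= G l)%MS.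
Proof.
have pE l : block_part th l c = c *m (E l)^T.
  apply/rowP => x; rewrite !mxE big_mkcond; apply: eq_bigr => a _.
  by rewrite !mxE; case: eqP; rewrite ?mulr1 ?mulr0.
split=> [/sub_sumsmxP[u ec] l|h].
  rewrite pE ec mulmx_suml; apply: summx_sub => l' _.
  by apply: submx_trans (sub_GE l (submxMl _ _)) _; case: eqP => //; rewrite sub0mx.
have -> : c = \sum_l (c *m (E l)^T) *m E l.
  apply/rowP => a; rewrite summxE (bigD1 (th a).1) //= big1 ?addr0.
    rewrite mxE (bigD1 (th a).2) //= big1 ?addr0.
      rewrite -pE !mxE -surjective_pairing eqxx mulr1 (bigD1 a) //= big1 ?addr0 //.
      by move=> b /andP[/eqP /th_inj -> /eqP].
    by move=> x xa; rewrite [E _ _ _]mxE [th a]surjective_pairing xpair_eqE eqxx /= eq_sym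
         (negbTE xa) mulr0.
  move=> l la; rewrite mxE big1 // => x _; rewrite [E _ _ _]mxE [th a]surjective_pairing.
  by rewrite xpair_eqE eq_sym (negbTE la) mulr0.
apply: summx_sub => l _; apply: (sumsmx_sup l) => //; rewrite genmxE submxMr //.
by rewrite -pE.
Qed.

Lemma rank_glue : \rank glue = (\sum_l \rank (G l))%N.
Proof.
have dir : mxdirect (\sum_l <<G l *m E l>>)%MS.
  apply/mxdirect_sumsP => l _; apply/eqP; rewrite -submx0; apply/rV_subP => v.
  rewrite sub_capmx => /andP[]; rewrite genmxE => /submxP[u ev] /sub_sumsmxP[w ew].
  have : v *m (E l)^T = 0.
    apply/eqP; rewrite -submx0 ew mulmx_suml; apply: summx_sub => l' /negbTE ll.
    by have := sub_GE l (submxMl (w l') <<G l' *m E l'>>%MS); rewrite ll.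
  by rewrite ev -mulmxA GEE eqxx mulmxA => ->; rewrite mul0mx sub0mx.
rewrite (mxdirectP dir) /=; apply: eq_bigr => l _; rewrite genmxE.
apply/eqP; rewrite eqn_leq mxrankM_maxl /=.
by have := GEE l l; rewrite eqxx => {1}<-; exact: mxrankM_maxl.
Qed.

End Glue.

(** * Reed-Solomon codes *)

Lemma inj_of_card (T : finType) (n : nat) : (n <= #|T|)%N ->
  exists f : 'I_n -> T, injective f.
Proof.
move=> nT; exists (fun i => enum_val (widen_ord nT i)).
by move=> i j /enum_val_inj /(congr1 val) /= /val_inj.
Qed.

Lemma poly_of_zeros (F : fieldType) (n h : nat) (al : 'I_n -> F) (p : {poly F}) (Z : {set 'I_n}) :
  injective al -> (size p <= h)%N -> (h <= #|Z|)%N ->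
  (forall a, a \in Z -> p.[al a] = 0) -> p = 0.
Proof.
move=> al_inj sp hZ pZ; apply/eqP; apply: contraT => p0.
have : (size [seq al a | a <- enum Z] < size p)%N.
  apply: max_poly_roots => //; last by rewrite map_inj_uniq ?enum_uniq.
  by apply/allP => _ /mapP[a + ->]; rewrite mem_enum => /pZ; rewrite rootE => ->.
by rewrite size_map -cardE ltnNge (leq_trans sp hZ).
Qed.

(** [w] lists the coefficients of a polynomial of degree below [k], and the Vandermonde product
    lists its values. *)
Lemma row_poly_zeros (F : fieldType) (n h k : nat) (al : 'I_n -> F) (w : 'rV[F]_h)
    (Z : {set 'I_n}) :
  injective al -> (forall i : 'I_h, (k <= i)%N -> w 0 i = 0) -> (k <= #|Z|)%N ->
  (forall a, a \in Z -> (w *m \matrix_(i < h, b < n) al b ^+ i) 0 a = 0) -> w = 0.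
Proof.
move=> al_inj wk hZ hw; pose p : {poly F} := \sum_(i < h) w 0 i *: 'X^i.
have p0 : p = 0.
  apply: (poly_of_zeros (h := k) (Z := Z) al_inj) => // [|a aZ].
    apply: (leq_trans (size_sum _ _ _)); apply/bigmax_leqP => i _.
    have [ki|ik] := leqP k i; first by rewrite wk // scale0r size_poly0.
    by apply: leq_trans (size_scale_leq _ _) _; rewrite size_polyXn.
  rewrite horner_sum -[RHS](hw a aZ) mxE; apply: eq_bigr => i _.
  by rewrite mxE !hornerE.
apply/rowP => i; rewrite mxE; have := congr1 (fun q : {poly F} => q`_i) p0.
rewrite coef0 coef_sum (bigD1 i) //= coefZ coefXn eqxx mulr1 big1 ?addr0 //.
by move=> j ji; rewrite coefZ coefXn val_eqE eq_sym (negbTE ji) mulr0.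
Qed.

(** The Vandermonde matrix serves for all [k] at once: a word spanned by its first [k] rows is a
    polynomial of degree below [k], with at least [k] zeros outside [Q]. *)
Lemma reed_solomon (F : finFieldType) (B : nat) : (B <= #|F|)%N ->
  exists2 g : 'M[F]_B, g \in unitmx &
    forall (k : nat) (c : 'rV[F]_B) (Q : {set 'I_B}), (c <= (pid_mx k : 'M_B) *m g)%MS ->
      (k + #|Q| <= B)%N -> (forall a, c 0 a != 0 -> a \in Q) -> c = 0.
Proof.
move=> /inj_of_card[al al_inj].
exists (\matrix_(i, a) al a ^+ i).
  rewrite -row_free_unit; apply: inj_row_free => w w0.
  apply: (row_poly_zeros (k := B) (Z := setT) al_inj) => [i||a _].
  - by rewrite leqNgt ltn_ord.
  - by rewrite cardsT card_ord.
  - by rewrite w0 mxE.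
move=> k c Q /submxP[u]; rewrite mulmxA => -> kQ cQ.
suff -> : u *m (pid_mx k : 'M_B) = 0 by rewrite mul0mx.
apply: (row_poly_zeros (k := k) (Z := ~: Q) al_inj) => [i ki||a].
- rewrite mxE big1 // => j _.
  by rewrite mxE; case: eqP => [->|_] /=; rewrite 1?ltnNge ?ki /= mulr0.
- by have := cardsC Q; rewrite card_ord; lia.
- by rewrite inE => aQ; apply/eqP; apply: contraR aQ; exact: cQ.
Qed.


(** * Random shifts *)

Section Inequalities.
Variable R : realFieldType.
Implicit Types (x : R).

Lemma bernoulli x (m : nat) : 0 <= x -> 1 + m%:R * x <= (1 + x) ^+ m.
Proof.
move=> x0; elim: m => [|m IH]; first by rewrite mul0r addr0.
rewrite exprS; apply: le_trans (_ : (1 + x) * (1 + m%:R * x) <= _).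
  have m0 : 0 <= m%:R :> R by [].
  rewrite -natr1; nra.
by rewrite ler_wpM2l // addr_ge0.
Qed.

Lemma expr_inv_bound x (m : nat) : 0 <= x -> m%:R * x <= 1 -> (1 + x) ^+ m * (1 - m%:R * x) <= 1.
Proof.
move=> x0; elim: m => [|m IH] mx1; first by rewrite mul0r subr0 mulr1.
have m0 : 0 <= m%:R :> R by [].
have mx : m%:R * x <= 1 by move: mx1; rewrite -natr1; nra.
apply: le_trans (IH mx); rewrite exprSr -mulrA ler_wpM2l ?exprn_ge0 ?addr_ge0 //.
by rewrite -natr1; nra.
Qed.

End Inequalities.

Section Shift.
Variables (n A B : nat).
Hypothesis ABn : (A.+1 * B.+1 <= n)%N.
Implicit Types (s : {ffun 'I_B.+1 -> 'I_A.+1}) (X : {set 'I_n}).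

Definition column (a : 'I_n) : 'I_B.+1 := inord (a %% B.+1).
Definition height (a : 'I_n) : 'I_A.+1 := inord (a %/ B.+1).

(* The first A.+1 * B.+1 coordinates form an array with B.+1 columns, the column
   x is rotated by s x, and the rows of the result are the blocks inl l. Each
   remaining coordinate a is a block inr a, with dummy position ord0. *)
Definition shift s (a : 'I_n) : ('I_A.+1 + 'I_n)%type * 'I_B.+1 :=
  if (a < A.+1 * B.+1)%N then (inl (height a - s (column a)), column a)
  else (inr a, ord0).

Lemma shift_inj s : injective (shift s).
Proof.
move=> a b; rewrite /shift; case: ifP => ha; case: ifP => hb //; last by case.
move=> e; have ec := congr1 snd e; rewrite /= in ec.
have := congr1 (fun p : ('I_A.+1 + 'I_n) * 'I_B.+1 => if p.1 is inl y then y else 0) e.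
rewrite /= ec => /addIr eh.
apply: val_inj => /=; rewrite (divn_eq a B.+1) (divn_eq b B.+1).
have := congr1 val ec; have := congr1 val eh; rewrite /= !inordK ?ltn_pmod //;
  rewrite ?ltn_divLR // => -> -> //.
Qed.

Lemma shift_surj s (l : 'I_A.+1) (x : 'I_B.+1) : exists a, shift s a = (inl l, x).
Proof.
pose y := l + s x.
have lt : (y * B.+1 + x < A.+1 * B.+1)%N.
  apply: (@leq_trans (y.+1 * B.+1)); last by rewrite leq_mul2r ltn_ord orbT.
  by rewrite mulSn addnC ltn_add2r.
exists (Ordinal (leq_trans lt ABn)); rewrite /shift /= lt.
have -> : column (Ordinal (leq_trans lt ABn)) = x.
  by rewrite /column /= modnMDl modn_small // inord_val.
have -> : height (Ordinal (leq_trans lt ABn)) = y.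
  by rewrite /height /= divnMDl // divn_small // addn0; apply: val_inj; rewrite /= inordK ?ltn_pmod.
by rewrite /y addrK.
Qed.

Definition hits s (l : 'I_A.+1) X : {set 'I_B.+1} :=
  [set x | [exists a in X, shift s a == (inl l, x)]].

(** The columns are rotated independently, so the exponential moment factors over them. A column
    with [c x] points of [X] is hit under at most [c x] rotations, and Bernoulli's inequality turns
    this into a power. *)
Lemma sum_expr_hits (R : realFieldType) (z : R) (l : 'I_A.+1) X : 1 <= z ->
  \sum_s z ^+ #|hits s l X| <=
  A.+1%:R ^+ B.+1 * (1 + (z - 1) / A.+1%:R) ^+ #|X|.
Proof.
move=> z1; pose P x (t : 'I_A.+1) := [exists a in X, [&& (a < A.+1 * B.+1)%N,
   column a == x & height a - t == l]].
have hitE s x : (x \in hits s l X) = P x (s x).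
  rewrite inE; apply/existsP/existsP => -[a /andP[aX]].
    rewrite /shift; case: ifP => //= alt; rewrite xpair_eqE => /andP[/eqP el /eqP ec].
    exists a; rewrite aX alt ec eqxx /=.
    have := congr1 (fun p : 'I_A.+1 + 'I_n => if p is inl y then y else 0) el.
    by rewrite /= ec => ->.
  case/and3P=> alt /eqP ec /eqP el; exists a.
  by rewrite aX /shift alt ec el eqxx.
pose f x t : R := if P x t then z else 1.
have -> : \sum_s z ^+ #|hits s l X| = \prod_x \sum_t f x t.
  rewrite bigA_distr_bigA; apply: eq_bigr => s _.
  rewrite -prodr_const big_mkcond /=; apply: eq_bigr => x _.
  by rewrite hitE.
pose c x := #|[set a in X | column a == x]|.
have A0 : 0 < A.+1%:R :> R by rewrite ltr0n.
have u0 : 0 <= (z - 1) / A.+1%:R by rewrite divr_ge0 ?subr_ge0 // ltW.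
have hf x : 0 <= \sum_t f x t <= A.+1%:R * (1 + (z - 1) / A.+1%:R) ^+ c x.
  apply/andP; split.
    by apply: sumr_ge0 => t _; rewrite /f; case: ifP => _ //; lra.
  have cP : (#|[set t | P x t]| <= c x)%N.
    apply: leq_trans (leq_imset_card (fun a => height a - l) _).
    apply: subset_leq_card; apply/subsetP => t; rewrite inE => /existsP[a /andP[aX]].
    case/and3P => _ ec /eqP el; apply/imsetP; exists a; first by rewrite inE aX.
    by rewrite -el opprB addrC subrK.
  have -> : \sum_t f x t = A.+1%:R + (z - 1) * #|[set t | P x t]|%:R.
    transitivity (\sum_t (1 + (z - 1) * (P x t)%:R)).
      by apply: eq_bigr => t _; rewrite /f; case: (P x t) => /=; ring.
    rewrite big_split /= sumr_const card_ord -mulr_sumr -natr_sum.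
    congr (_ + _ * _%:R); rewrite -sum1_card [RHS]big_mkcond; apply: eq_bigr => t _.
    by rewrite inE; case: (P x t).
  apply: (@le_trans _ _ (A.+1%:R * (1 + (z - 1) / A.+1%:R * (c x)%:R))).
    rewrite mulrDr mulr1 lerD2l mulrA mulrCA mulfV ?gt_eqF // mulr1.
    by rewrite ler_wpM2l ?subr_ge0 // ler_nat.
  by rewrite ler_pM2l // mulrC bernoulli.
apply: le_trans (ler_prod _ (fun x _ => hf x)) _.
rewrite big_split /= prodr_const card_ord prodrXr.
suff -> : (\sum_x c x)%N = #|X| by [].
rewrite -sum1_card (partition_big column xpredT) //=; apply: eq_bigr => x _.
by rewrite sum1_card; apply: eq_card => a; rewrite !inE.
Qed.

Lemma card_many_hits (R : realFieldType) (z : R) (l : 'I_A.+1) X (q : nat) : 1 <= z ->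
  #|[set s | (q < #|hits s l X|)%N]|%:R * z ^+ q.+1 <=
  A.+1%:R ^+ B.+1 * (1 + (z - 1) / A.+1%:R) ^+ #|X|.
Proof.
move=> z1; apply: le_trans (sum_expr_hits l X z1).
rewrite -sum1_card natr_sum mulr_suml big_mkcond; apply: ler_sum => s _ /=.
rewrite inE; case: ifP => [h|_]; last by rewrite exprn_ge0 //; lra.
by rewrite mul1r ler_weXn2l.
Qed.

(** Markov's inequality for [z ^+ hits], and a union bound over the sets [X i] and the blocks
    [l]. *)
Lemma exists_shift (R : realFieldType) (z : R) (I : finType) (X : I -> {set 'I_n}) (q0 q : nat) :
  1 <= z -> (forall i, (#|X i| <= q0)%N) ->
  (#|I| * A.+1)%:R * (1 + (z - 1) / A.+1%:R) ^+ q0 < z ^+ q.+1 ->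
  exists s, forall i l, (#|hits s l (X i)| <= q)%N.
Proof.
move=> z1 hX hlt.
case: (pickP (fun s => [forall i, [forall l, (#|hits s l (X i)| <= q)%N]])) => [s|no].
  by move=> /forallP h; exists s => i l; have /forallP := h i.
have A0 : 0 < A.+1%:R :> R by rewrite ltr0n.
have z0 : 0 < z ^+ q.+1 by rewrite exprn_gt0 //; lra.
have u0 : 0 <= (z - 1) / A.+1%:R by rewrite divr_ge0 ?subr_ge0 // ltW.
suff : A.+1%:R ^+ B.+1 * z ^+ q.+1 <= A.+1%:R ^+ B.+1 *
    ((#|I| * A.+1)%:R * (1 + (z - 1) / A.+1%:R) ^+ q0).
  by rewrite ler_pM2l ?exprn_gt0 // leNgt hlt.
have cS : #|{: {ffun 'I_B.+1 -> 'I_A.+1}}| = (A.+1 ^ B.+1)%N by rewrite card_ffun !card_ord.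
have cov : (A.+1 ^ B.+1 <= \sum_(p : I * 'I_A.+1) #|[set s | (q < #|hits s p.2 (X p.1)|)%N]|)%N.
  rewrite -cS; apply: leq_trans (_ : (#|\bigcup_(p : I * 'I_A.+1)
     [set s | (q < #|hits s p.2 (X p.1)|)%N]| <= _)%N); last exact: card_bigcup_le.
  rewrite -cardsT; apply: subset_leq_card; apply/subsetP => s _.
  have := no s; move/negbT; rewrite negb_forall => /existsP[i].
  rewrite negb_forall => /existsP[l]; rewrite -ltnNge => h.
  by apply/bigcupP; exists (i, l); rewrite ?inE.
apply: le_trans (_ : (\sum_(p : I * 'I_A.+1) #|[set s | (q < #|hits s p.2 (X p.1)|)%N]|)%:R *
   z ^+ q.+1 <= _).
  by rewrite ler_pM2r // -natrX ler_nat.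
rewrite natr_sum mulr_suml.
apply: le_trans (ler_sum _ (fun p _ => card_many_hits p.2 (X p.1) q z1)) _.
rewrite -mulr_sumr ler_wpM2l ?exprn_ge0 //.
set w := (1 + _) ^+ q0.
have -> : (#|I| * A.+1)%:R * w = \sum_(p : I * 'I_A.+1) w.
  by rewrite sumr_const card_prod card_ord mulr_natl.
apply: ler_sum => p _.
by rewrite ler_weXn2l // lerDl.
Qed.

End Shift.

(** * Exactness from exactness on cells *)

Lemma in_cell_line (D n n' : nat) (Lab : finType) (th : 'I_D -> 'I_n -> Lab * 'I_n')
    (U : {set grid D n}) (v : grid D n) i x : (forall i, injective (th i)) ->
  (set_coord (cell_pos th v) i x \in in_cell th (cell th v) U) =
  [exists a, (set_coord v i a \in U) && (th i a == (cell th v i, x))].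
Proof.
move=> th_inj; apply/in_cellP/existsP => [[v' [v'U ec ex]]|[a /andP[aU /eqP ea]]].
  have thE j : th j (v' j) = (cell th v j, set_coord (cell_pos th v) i x j).
    by rewrite -ec -ex !ffunE -surjective_pairing.
  exists (v' i); rewrite thE set_coord_eq eqxx andbT.
  suff <- : v' = set_coord v i (v' i) by [].
  apply/ffunP => j; rewrite ffunE; case: eqP => [->//|/eqP ji]; apply: (th_inj j).
  by rewrite thE set_coord_neq // !ffunE -surjective_pairing.
exists (set_coord v i a); split=> //; apply/ffunP => j; rewrite !ffunE;
  by case: eqP => // ->; rewrite ea /= ?ffunE.
Qed.

Section Assemble.
Variables (F : finFieldType) (D n A B : nat).
Hypothesis ABn : (A.+1 * B.+1 <= n)%N.
Variable sg : 'I_D -> {ffun 'I_B.+1 -> 'I_A.+1}.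
Let th i := shift (n := n) (sg i).

Lemma sum_minn (kap k m : nat) :
  (\sum_(l < m) minn kap (k - l * kap) = minn k (m * kap))%N.
Proof.
elim: m => [|m IH]; first by rewrite big_ord0 minn0.
by rewrite big_ord_recr /= IH; lia.
Qed.

(** All blocks share the matrices [g'] and differ only in the number of rows used, so every cell
    carries a tuple [code k' g']. The glued codes have dimension exactly [k i]. *)
Lemma assemble (g' : 'I_D -> 'M[F]_B.+1) (kap : nat) (k : 'I_D -> nat) (U : {set grid D n}) :
  (forall i, g' i \in unitmx) -> (kap <= B.+1)%N -> (forall i, (k i <= A.+1 * kap)%N) ->
  (forall k' b, (forall i, (k' i <= kap)%N) -> exact (code k' g') (in_cell th b U)) ->
  (forall v i, v \in U -> fullline (in_cell th (cell th v) U) i (cell_pos th v) -> fullline U i v) ->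
  exists2 g : {ffun 'I_D -> 'M[F]_n}, forall i, g i \in unitmx & exact (code k g) U.
Proof.
move=> ug' kapB kk hex hfull.
(* The dimension [k i] is handed out greedily, at most [kap] per full block; leftover coordinates
   carry the zero code. *)
pose kl i (l : 'I_A.+1 + 'I_n) : nat := if l is inl l then minn kap (k i - l * kap) else 0.
pose G i l : 'M[F]_B.+1 := pid_mx (kl i l) *m g' i.
have klkap i l : (kl i l <= kap)%N by case: l => [l|l] /=; rewrite ?geq_minl.
have th_inj i : injective (th i) by exact: shift_inj.
have hG i l : G i l = 0 \/ forall x, exists a, th i a = (l, x).
  case: l => l; [right => x; exact: shift_surj|left].
  by rewrite /G /= pid_mx_0 mul0mx.
have rk i : \rank (glue (th i) (G i)) = k i.
  rewrite rank_glue //.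
  have rG l : \rank (G i l) = kl i l.
    rewrite mxrankMfree ?row_free_unit // rank_pid_mx //; apply: leq_trans kapB; exact: klkap.
  under eq_bigr do rewrite rG.
  by rewrite big_sumType /= sum_minn big1 // addn0; apply/minn_idPl.
have /fin_all_exists2[g ug hg] := fun i => pid_row_ebase (glue (th i) (G i)).
exists [ffun i => g i] => [i|]; first by rewrite ffunE.
apply: (@exact_eqmx _ _ _ (fun i => glue (th i) (G i))).
  by move=> i; apply: eqmx_sym; rewrite /code ffunE -{1}(rk i); exact: hg.
apply: (@exact_cells _ _ _ _ _ th th_inj _ G) => // [i c|b].
  exact: glue_pull.
exact: hex.
Qed.

End Assemble.

(** One tuple for all dimensions and all closed sets is required, because the cells of a single set
    show many traces and dimension vectors while sharing their matrices. *)
Definition good_tuple (F : finFieldType) (D n s kap : nat) : Prop :=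
  exists2 g : {ffun 'I_D -> 'M[F]_n}, forall i, g i \in unitmx &
    forall (k : 'I_D -> nat) (U : {set grid D n}), (forall i, (k i <= kap)%N) ->
      line_closed s U -> exact (code k g) U.

(** Suitable rotations leave at most [s'] points of every non-full line in each block. Then all
    cells are [s']-closed, and the good tuple at the block length is exact on them. *)
Lemma exact_step (F : finFieldType) (D n A B s s' kap : nat) (R : realFieldType) (z : R)
    (k : 'I_D -> nat) (U : {set grid D n}) :
  (A.+1 * B.+1 <= n)%N -> (kap <= B.+1)%N -> (0 < s' <= B)%N -> 1 <= z ->
  (n ^ D * A.+1)%:R * (1 + (z - 1) / A.+1%:R) ^+ s < z ^+ s'.+1 ->
  good_tuple F D B.+1 s' kap -> (forall i, (k i <= A.+1 * kap)%N) -> line_closed s U ->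
  exists2 g : {ffun 'I_D -> 'M[F]_n}, forall i, g i \in unitmx & exact (code k g) U.
Proof.
move=> ABn kapB /andP[s'0 s'B] z1 hz [g' ug' hg'] kk Us.
pose X i (v : grid D n) := if fullline U i v then set0 else [set a | set_coord v i a \in U].
have cN : #|grid D n| = (n ^ D)%N by rewrite card_ffun !card_ord.
have /fin_all_exists[sg hsg] i : exists s : {ffun 'I_B.+1 -> 'I_A.+1},
    forall v l, (#|hits s l (X i v)| <= s')%N.
  apply: (@exists_shift n A B R z _ (X i) s s'); rewrite ?cN // => v.
  by rewrite /X; case: ifP => [_|/negbT /Us //]; rewrite cards0.
pose th i := shift (n := n) (sg i).
have th_inj i : injective (th i) by exact: shift_inj.
have few v i : ~~ fullline U i v ->
    (#|[set x | set_coord (cell_pos th v) i x \in in_cell th (cell th v) U]| <= s')%N.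
  move=> nf; case E : (cell th v i) => [l|l].
    apply: leq_trans (hsg i v l); apply: subset_leq_card; apply/subsetP => x.
    rewrite inE in_cell_line // => /existsP[a /andP[aU ea]].
    by rewrite inE; apply/existsP; exists a; rewrite /X (negbTE nf) inE aU -E.
  (* A leftover coordinate fills only the position [ord0] of its block, so at most one point is
     present. *)
  apply: leq_trans s'0; rewrite -(cards1 (ord0 : 'I_B.+1)); apply: subset_leq_card.
  apply/subsetP => x; rewrite [in X in X -> _]inE in_cell_line // => /existsP[a /andP[_ /eqP]].
  by rewrite E /th /shift inE; case: ifP => // _ [_ ->].
apply: (@assemble F D n A B ABn sg g' kap k U) => //.
- move=> k' b k'kap; apply: hg' => // i w nf.
  have [->|[x]] := set_0Vmem [set a | set_coord w i a \in in_cell th b U].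
    by rewrite cards0.
  rewrite inE => /in_cellP[v [vU ec ex]].
  have cw : set_coord (cell_pos th v) i (w i) = w by rewrite ex set_coordK set_coord_id.
  have eset : [set a | set_coord w i a \in in_cell th b U] =
     [set x | set_coord (cell_pos th v) i x \in in_cell th (cell th v) U].
    by apply/setP => y; rewrite [LHS]inE [RHS]inE ec -[in LHS]cw set_coordK.
  rewrite eset; have [f|] := boolP (fullline U i v); last exact: few.
  case E : (cell th v i) => [l|l]; last first.
    apply: leq_trans s'0; rewrite -(cards1 (ord0 : 'I_B.+1)); apply: subset_leq_card.
    apply/subsetP => y; rewrite [in X in X -> _]inE in_cell_line // => /existsP[a /andP[_ /eqP]].
    by rewrite E /th /shift inE; case: ifP => // _ [_ ->].
  case/negP: nf; apply/fulllineP => y; have := f; move/fulllineP => fU.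
  have [a ea] := shift_surj ABn (sg i) l y.
  have : y \in [set x | set_coord (cell_pos th v) i x \in in_cell th (cell th v) U].
    by rewrite inE in_cell_line //; apply/existsP; exists a; rewrite fU E /th ea eqxx.
  by rewrite -eset inE.
(* A full line of a cell has [B.+1 > s'] points, too many to come from a non-full line of [U]. *)
- move=> v i vU /fulllineP cf; apply: contraT => /few.
  rewrite (_ : [set x | _] = setT) ?cardsT ?card_ord; first by rewrite ltnNge s'B.
  by apply/setP => x; rewrite [LHS]inE cf inE.
Qed.

(** * Constant length: few thin coordinates in every cell *)

Definition upd (D : nat) (T : finType) (f : {ffun 'I_D -> T}) i (x : T) : {ffun 'I_D -> T} :=
  [ffun j => if j == i then x else f j].

(** Resampling one coordinate preserves the uniform distribution: exchanging [x] with [f i] is an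
    involution on pairs. *)
Lemma sum_card_upd (D : nat) (T : finType) (S : {set {ffun 'I_D -> T}}) i :
  (\sum_f #|[set x | upd f i x \in S]| = #|S| * #|T|)%N.
Proof.
pose h (p : {ffun 'I_D -> T} * T) := (upd p.1 i p.2, p.1 i).
have hK : involutive h.
  case=> f x; rewrite /h /= ffunE eqxx; congr (_, _).
  by apply/ffunP => j; rewrite !ffunE; case: eqP => // ->.
transitivity (\sum_(p : {ffun 'I_D -> T} * T) ((h p).1 \in S : nat))%N.
  rewrite -(pair_bigA _ (fun f x => (upd f i x \in S : nat))) /=.
  apply: eq_bigr => f _; rewrite -sum1_card big_mkcond; apply: eq_bigr => x _.
  by rewrite inE; case: (_ \in S).
rewrite (reindex_inj (inv_inj hK)).
transitivity (\sum_(p : {ffun 'I_D -> T} * T) (p.1 \in S : nat))%N.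
  by apply: eq_bigr => p _; rewrite hK.
rewrite -(pair_bigA _ (fun f x => (f \in S : nat))) /=.
under eq_bigr do rewrite sum_nat_const.
rewrite -big_distrr /= mulnC; congr (_ * _)%N.
by rewrite -sum1_card [RHS]big_mkcond; apply: eq_bigr => f _; case: (_ \in S).
Qed.

Section Base.
Variables (D n A B s q : nat).
Hypothesis ABn : (A.+1 * B.+1 <= n)%N.
Variable U : {set grid D n}.
Hypothesis Us : line_closed s U.
Let Sg := {ffun 'I_B.+1 -> 'I_A.+1}.
Implicit Types (f : {ffun 'I_D -> Sg}) (b : {ffun 'I_D -> 'I_A.+1}) (i : 'I_D).

(** The block condition is imposed only in the directions other than [i], so that the set is
    independent of the rotation [f i]. *)
Definition thin_traces i b f : {set 'I_n} :=
  [set a | [exists v in U, [&& v i == a, ~~ fullline U i v &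
     [forall (j | j != i), (shift (f j) (v j)).1 == inl (b j)]]]].

(** Fixing positions in the other directions singles out one non-full line, which has at most [s]
    points of [U]. *)
Lemma card_thin_traces i b f : (#|thin_traces i b f| <= B.+1 ^ D * s)%N.
Proof.
pose S (w : grid D B.+1) := [set a | [exists v in U, [&& v i == a, ~~ fullline U i v &
   [forall (j | j != i), shift (f j) (v j) == (inl (b j), w j)]]]].
have sub : thin_traces i b f \subset \bigcup_w S w.
  apply/subsetP => a; rewrite inE => /existsP[v /and4P[vU va nf /forallP h]].
  apply/bigcupP; exists [ffun j => (shift (f j) (v j)).2] => //.
  rewrite inE; apply/existsP; exists v; rewrite vU va nf; apply/forallP => j.
  apply/implyP => ji; have /implyP/(_ ji)/eqP e := h j.
  by rewrite [shift _ _]surjective_pairing e ffunE.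
apply: leq_trans (subset_leq_card sub) _; apply: leq_trans (card_bigcup_le _) _.
apply: (@leq_trans (\sum_(w : grid D B.+1) s)); last first.
  by rewrite sum_nat_const card_ffun !card_ord.
apply: leq_sum => w _.
have [->|[a0]] := set_0Vmem (S w); first by rewrite cards0.
rewrite inE => /existsP[v0 /and4P[v0U v0a nf0 /forallP h0]].
apply: leq_trans (Us nf0); apply: subset_leq_card; apply/subsetP => a.
rewrite !inE => /existsP[v /and4P[vU /eqP <- nf /forallP h]].
suff <- : v = set_coord v0 i (v i) by [].
apply/ffunP => j; rewrite ffunE; case: eqP => [->//|/eqP ji].
apply: (@shift_inj n A B (f j)).
by have /implyP/(_ ji)/eqP -> := h j; have /implyP/(_ ji)/eqP -> := h0 j.
Qed.

Lemma thin_traces_upd i b f (x : Sg) : thin_traces i b (upd f i x) = thin_traces i b f.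
Proof.
apply/setP => a; rewrite !inE; apply: eq_existsb => v; congr [&& _, _, _ & _].
by apply: eq_forallb => j; rewrite ffunE; case: eqP.
Qed.

(** With the other rotations fixed, [f i] is uniform and the thin traces are a fixed small set, so
    the moment bound applies; then a union bound over directions and cells. *)
Lemma exists_thin_shift (R : realFieldType) (z : R) : 1 <= z ->
  (D * A.+1 ^ D)%:R * (1 + (z - 1) / A.+1%:R) ^+ (B.+1 ^ D * s) < z ^+ q.+1 ->
  exists f, forall i b, (#|hits (f i) (b i) (thin_traces i b f)| <= q)%N.
Proof.
move=> z1 hz; pose bad i b := [set f : {ffun 'I_D -> Sg} | (q < #|hits (f i) (b i) (thin_traces i b f)|)%N].
case: (pickP (fun f : {ffun 'I_D -> Sg} => [forall i, [forall b, f \notin bad i b]])) => [f /forallP h|no].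
  by exists f => i b; have /forallP/(_ b) := h i; rewrite inE -leqNgt.
pose N := #|{: {ffun 'I_D -> Sg}}|; pose w : R := (1 + (z - 1) / A.+1%:R) ^+ (B.+1 ^ D * s).
have A0 : 0 < A.+1%:R :> R by rewrite ltr0n.
have u1 : 1 <= 1 + (z - 1) / A.+1%:R by rewrite lerDl divr_ge0 ?subr_ge0 // ltW.
have cS : #|Sg|%:R = A.+1%:R ^+ B.+1 :> R by rewrite card_ffun !card_ord natrX.
have S0 : 0 < #|Sg|%:R :> R by rewrite cS exprn_gt0.
have N0 : 0 < N%:R :> R.
  by rewrite ltr0n; apply/card_gt0P; exists [ffun=> [ffun=> ord0]].
have hbad i b : #|bad i b|%:R * z ^+ q.+1 <= N%:R * w.
  rewrite -(ler_pM2l S0) mulrA -natrM mulnC -(sum_card_upd (bad i b) i).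
  rewrite natr_sum mulr_suml.
  apply: le_trans (_ : \sum_(f : {ffun 'I_D -> Sg}) #|Sg|%:R * w <= _); last first.
    by rewrite sumr_const -/N mulrCA [leRHS]mulr_natl.
  apply: ler_sum => f _.
  have -> : [set x | upd f i x \in bad i b] =
      [set x : Sg | (q < #|hits x (b i) (thin_traces i b f)|)%N].
    by apply/setP => x; rewrite !inE thin_traces_upd ffunE eqxx.
  apply: le_trans (card_many_hits B (b i) (thin_traces i b f) q z1) _.
  rewrite cS ler_wpM2l ?exprn_ge0 //.
  by rewrite ler_weXn2l // card_thin_traces.
have cov : (N <= \sum_(p : 'I_D * {ffun 'I_D -> 'I_A.+1}) #|bad p.1 p.2|)%N.
  apply: leq_trans (_ : (#|\bigcup_(p : 'I_D * {ffun 'I_D -> 'I_A.+1}) bad p.1 p.2| <= _)%N);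
    last exact: card_bigcup_le.
  rewrite /N -cardsT; apply: subset_leq_card; apply/subsetP => f _.
  have /negbT := no f; rewrite negb_forall => /existsP[i].
  rewrite negb_forall => /existsP[b]; rewrite negbK => h.
  by apply/bigcupP; exists (i, b).
suff : N%:R * z ^+ q.+1 <= N%:R * ((D * A.+1 ^ D)%:R * w).
  by rewrite ler_pM2l // leNgt hz.
apply: le_trans (_ : (\sum_(p : 'I_D * {ffun 'I_D -> 'I_A.+1}) #|bad p.1 p.2|)%:R * z ^+ q.+1 <= _).
  by rewrite ler_wpM2r ?ler_nat // exprn_ge0 //; lra.
rewrite natr_sum mulr_suml; apply: le_trans (ler_sum _ (fun p _ => hbad p.1 p.2)) _.
by rewrite sumr_const card_prod card_ffun !card_ord [leRHS]mulrCA [leRHS]mulr_natl.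
Qed.

End Base.

(** Each cell has at most [q] thin coordinates per direction, and [kap + q <= B.+1] keeps
    Reed-Solomon words of dimension at most [kap] from living on them. *)
Lemma exact_base (F : finFieldType) (D A B s q kap : nat) (R : realFieldType) (z : R)
    (k : 'I_D -> nat) (U : {set grid D (A.+1 * B.+1)}) :
  (kap + q <= B.+1)%N -> (q <= B)%N -> 1 <= z -> (B.+1 <= #|F|)%N ->
  (D * A.+1 ^ D)%:R * (1 + (z - 1) / A.+1%:R) ^+ (B.+1 ^ D * s) < z ^+ q.+1 ->
  (forall i, (k i <= A.+1 * kap)%N) -> line_closed s U ->
  exists2 g : {ffun 'I_D -> 'M[F]_(A.+1 * B.+1)}, forall i, g i \in unitmx & exact (code k g) U.
Proof.
move=> kq qB z1 BF hz kk Us; set n := (A.+1 * B.+1)%N in U Us *.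
have ABn : (A.+1 * B.+1 <= n)%N by [].
have [f hf] := exists_thin_shift (n := n) Us z1 hz.
have [g' ug' hg'] := reed_solomon BF.
pose th i := shift (n := n) (f i).
have th_inj i : injective (th i) by exact: shift_inj.
have thE i a : exists l, th i a = (inl l, column B a).
  by rewrite /th /shift ltn_ord; eexists.
(* At this length no coordinate is left over, so cells of grid points never meet the default
   [ord0]. *)
pose lab (b : {ffun 'I_D -> 'I_A.+1 + 'I_n}) : {ffun 'I_D -> 'I_A.+1} :=
  [ffun i => if b i is inl l then l else ord0].
have hit v i : v \in U -> ~~ fullline U i v ->
    cell_pos th v i \in hits (f i) (lab (cell th v) i) (thin_traces U i (lab (cell th v)) f).
  move=> vU nf; rewrite !inE; apply/existsP; exists (v i); apply/andP; split; last first.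
    by rewrite !ffunE -/(th i (v i)); have [l ->] := thE i (v i); rewrite eqxx.
  rewrite inE; apply/existsP; exists v; rewrite vU eqxx nf; apply/forallP => j.
  by apply/implyP => ji; rewrite !ffunE -/(th j (v j)); have [l ->] := thE j (v j).
apply: (@assemble F D n A B ABn f (fun=> g') kap k U) => // [|k' b k'kap|v i vU /fulllineP cf].
- lia.
- apply: exact_thin => i c hc cQ; apply: (hg' (k' i) c (thin_coords (in_cell th b U) i)) => //.
  apply: leq_trans (leq_add (k'kap i) _) kq; apply: leq_trans (hf i (lab b)).
  apply: subset_leq_card; apply/subsetP => x; rewrite inE => /existsP[w /and3P[/in_cellP]].
  case=> v [vU ec ex] /eqP <- nf; rewrite -ex -ec; apply: hit => //.
  apply: contra nf => /fulllineP fU; apply/fulllineP => y; rewrite -ex -ec in_cell_line //.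
  have [l el] := thE i (v i).
  have [a ea] := shift_surj ABn (f i) l y.
  by apply/existsP; exists a; rewrite fU ffunE el /th ea eqxx.
(* If the line of [U] were not full, all [B.+1] positions would be hits, more than [q]. *)
- apply: contraT => nf.
  have : (#|[set: 'I_B.+1]| <= q)%N.
    apply: leq_trans (hf i (lab (cell th v))); apply: subset_leq_card; apply/subsetP => x _.
    have := cf x; rewrite in_cell_line // => /existsP[a /andP[aU /eqP ea]].
    have := hit (set_coord v i a) i aU; rewrite fullline_set_coord => /(_ nf).
    have -> : cell th (set_coord v i a) = cell th v.
      apply/ffunP => j; rewrite !ffunE; case: eqP => // ->.
      by have := congr1 fst ea; rewrite /= ffunE.
    have -> // : cell_pos th (set_coord v i a) i = x.
    by have := congr1 snd ea; rewrite /= => <-; rewrite !ffunE eqxx.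
  rewrite cardsT card_ord; lia.
Qed.

(** * A tuple exact on all closed sets *)

Definition line_closedb (D n s : nat) (U : {set grid D n}) : bool :=
  [forall i, [forall v, ~~ fullline U i v ==> (#|[set a | set_coord v i a \in U]| <= s)%N]].

Lemma line_closedP (D n s : nat) (U : {set grid D n}) :
  reflect (line_closed s U) (line_closedb s U).
Proof.
apply: (iffP forallP) => [h i v nf|h i]; first exact: implyP (forallP (h i) v) nf.
by apply/forallP => v; apply/implyP; exact: h.
Qed.

Lemma card_set_grid (D n : nat) : #|{set grid D n}| = (2 ^ (n ^ D))%N.
Proof. by rewrite -cardsT -powersetT card_powerset cardsT card_ffun !card_ord. Qed.

(** Exactness on a single set is generic, so over a large field a union bound over dimension
    vectors, sets and singular tuples leaves a common tuple. *)
Lemma good_tuple_exists (F : finFieldType) (D n s kap : nat) :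
  (forall (k : 'I_D -> nat) (U : {set grid D n}), (forall i, (k i <= kap)%N) -> line_closed s U ->
     exists2 g : {ffun 'I_D -> 'M[F]_n}, forall i, g i \in unitmx & exact (code k g) U) ->
  (kap.+1 ^ D * 2 ^ (n ^ D) * (2 * n ^ D) + D * n < #|F|.-1)%N ->
  good_tuple F D n s kap.
Proof.
move=> hex hq; pose V := {ffun 'I_D -> 'M[F]_n}.
pose I := ({ffun 'I_D -> 'I_kap.+1} * {set grid D n})%type.
pose kk (f : {ffun 'I_D -> 'I_kap.+1}) (i : 'I_D) : nat := f i.
pose S (p : I) := if line_closedb s p.2 then
  [set g : V | [forall i, g i \in unitmx] && ~~ exactb (code (kk p.1) g) p.2] else set0.
pose S0 := [set g : V | ~~ [forall i, g i \in unitmx]].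
have hS p : (#|F|.-1 * #|S p| <= 2 * n ^ D * #|{: V}|)%N.
  rewrite /S; case: ifP => [/line_closedP Us|_]; last by rewrite cards0 muln0.
  have [|g ug exg] := hex (kk p.1) p.2 _ Us; last exact: card_not_exact exg.
  by move=> i; rewrite -ltnS ltn_ord.
have V0 : (0 < #|{: V}|)%N by apply/card_gt0P; exists [ffun=> 0].
case: (pickP (fun g : V => (g \notin S0) && [forall p, g \notin S p])) => [g|no].
  case/andP; rewrite inE negbK => /forallP ug /forallP hg; exists g => // k U kkap Us.
  pose f := [ffun i => inord (k i) : 'I_kap.+1].
  have := hg (f, U); rewrite /S /= (introT (line_closedP _ _) Us) inE (introT forallP ug) /= negbK.
  move/exactP; apply: eq_exact => i.
  by rewrite /code /kk ffunE inordK // ltnS.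
have cov : (#|{: V}| <= #|S0| + \sum_p #|S p|)%N.
  apply: leq_trans (leq_add (leqnn _) (card_bigcup_le S)).
  apply: leq_trans (leq_card_setU _ _); rewrite -cardsT; apply: subset_leq_card.
  apply/subsetP => g _; rewrite in_setU; have := negbT (no g).
  rewrite negb_and negbK => /orP[-> //|]; rewrite negb_forall => /existsP[p].
  by rewrite negbK => gp; apply/orP; right; apply/bigcupP; exists p.
have : (#|F|.-1 * #|{: V}| <= (D * n + kap.+1 ^ D * 2 ^ (n ^ D) * (2 * n ^ D)) * #|{: V}|)%N.
  apply: leq_trans (leq_mul (leqnn _) cov) _; rewrite mulnDr mulnDl leq_add //.
    exact: card_not_unit.
  rewrite big_distrr /= -mulnA.
  apply: leq_trans (leq_sum _ (fun p _ => hS p)) _.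
  by rewrite sum_nat_const card_prod card_ffun !card_ord card_set_grid.
by rewrite leq_pmul2r // leqNgt addnC hq.
Qed.

(** * Numerical estimates *)

Section Numerics.
Variable R : realFieldType.
Implicit Types (x : R).

(* Markov's inequality for z ^+ hits with z = 1 + 8 x beats the union bound: the
   margin 256 h y ^ 2 between the exponents outweighs the second-order term x ^+ 2. *)
Lemma step_bound (n D y h : nat) x : (0 < y)%N -> (n ^ D * 8 <= 2 ^ (h * y))%N ->
  x = (64 * y)%:R^-1 ->
  (n ^ D * 8)%:R * (1 + x) ^+ (64 * h * (8 * y ^ 3 + 4 * y ^ 2)) <
  (1 + 8 * x) ^+ (64 * h * (y ^ 3 + y ^ 2)).+1.
Proof.
move=> y0 hn ex; pose T := (64 * h * (y ^ 3 + y ^ 2))%N; pose E := (128 * h * y ^ 2)%N.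
have Y0 : 0 < y%:R :> R by rewrite ltr0n.
have Y1 : 1 <= y%:R :> R by rewrite ler1n.
have xE : x * (64 * y%:R) = 1 by rewrite ex natrM mulVf // mulf_neq0 ?gt_eqF.
have x0 : 0 < x by rewrite ex invr_gt0 ltr0n muln_gt0.
have x1 : x <= 1 / 64 by nra.
have e1 : (1 + x) ^+ (64 * h * (8 * y ^ 3 + 4 * y ^ 2)) * (1 + x) ^+ (2 * E) = ((1 + x) ^+ 8) ^+ T.
  by rewrite -exprD -exprM; congr (_ ^+ _); rewrite /E /T; ring.
have h8 : (1 + x) ^+ 8 <= (1 + 8 * x) * (1 + 64 * x ^+ 2).
  have a2 : (1 + x) ^+ 2 <= 1 + 2 * x + x ^+ 2 by rewrite expr2; nra.
  have a4 : ((1 + x) ^+ 2) ^+ 2 <= 1 + 4 * x + 7 * x ^+ 2 by rewrite !expr2; nra.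
  have a8 : (((1 + x) ^+ 2) ^+ 2) ^+ 2 <= (1 + 4 * x + 7 * x ^+ 2) ^+ 2.
    by rewrite ler_pXn2r // nnegrE ?exprn_ge0 ?addr_ge0 ?mulr_ge0 ?exprn_ge0 ?ltW.
  rewrite -!exprM in a8; apply: le_trans a8 _; rewrite !expr2; nra.
pose w : R := 1 + 64 * x ^+ 2.
have w1 : 1 <= w by rewrite lerDl mulr_ge0 ?exprn_ge0 ?ltW.
(* As [y * (64 * x ^+ 2) = x], the power [w ^+ y] costs at most [1 / (1 - x)]. What is left of
   [(1 + x) ^+ 2] is at least [1 + x / 2], which pays for the union bound. *)
have hw : w ^+ y * (1 + x / 2) <= (1 + x) ^+ 2.
  have xy : 64 * x ^+ 2 = x / y%:R.
    by apply: (mulIf (x := y%:R)); rewrite ?gt_eqF // divfK ?gt_eqF // expr2; nra.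
  have yx : y%:R * (64 * x ^+ 2) = x by rewrite xy mulrC divfK ?gt_eqF.
  have := @expr_inv_bound R (64 * x ^+ 2) y; rewrite yx -/w => hb.
  have {}hb : w ^+ y * (1 - x) <= 1.
    by apply: hb; rewrite ?mulr_ge0 ?exprn_ge0 ?ltW //; lra.
  have wy0 : 0 <= w ^+ y by rewrite exprn_ge0 //; lra.
  have h3 : 1 + x / 2 <= (1 + x) ^+ 2 * (1 - x) by rewrite expr2; nra.
  apply: le_trans (ler_wpM2l wy0 h3) _; rewrite mulrCA.
  by rewrite ler_piMr // exprn_ge0 // addr_ge0 // ltW.
(* By Bernoulli's inequality [(1 + x / 2) ^+ (128 * y)] is at least 2, because
   [x = 1 / (64 * y)]. *)
have hE : (n ^ D * 8)%:R <= (1 + x / 2) ^+ E.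
  apply: le_trans (_ : (2 ^ (h * y))%:R <= _); first by rewrite ler_nat.
  have -> : E = (128 * y * (h * y))%N by rewrite /E; ring.
  have := @bernoulli R (x / 2) (128 * y); rewrite natrM => h2.
  have {h2}h2 : 2 <= (1 + x / 2) ^+ (128 * y).
    by apply: le_trans (h2 _); [nra | lra].
  rewrite exprM natrX lerXn2r // nnegrE ?exprn_ge0 //; lra.
have hwT : w ^+ T <= (w ^+ y) ^+ E.
  rewrite -exprM ler_weXn2l // /T /E.
  have : (y ^ 2 <= y ^ 3)%N by rewrite leq_pexp2l.
  have -> : (y * (128 * h * y ^ 2) = 64 * h * (y ^ 3 + y ^ 3))%N by ring.
  by move=> hy; rewrite leq_mul2l leq_add2l hy orbT.
have p0 : 0 < (1 + x) ^+ (2 * E) by rewrite exprn_gt0 // addr_gt0.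
rewrite -(ltr_pM2r p0) -mulrA e1.
apply: le_lt_trans (_ : (1 + x / 2) ^+ E * ((1 + 8 * x) ^+ T * w ^+ T) < _).
  rewrite -exprMn; apply: ler_pM => //; rewrite ?exprn_ge0 ?addr_ge0 ?(ltW x0) //.
  rewrite lerXn2r ?nnegrE ?exprn_ge0 ?mulr_ge0 ?addr_ge0 ?mulr_ge0 ?exprn_ge0 ?(ltW x0) //.
apply: le_lt_trans (_ : (1 + 8 * x) ^+ T * (1 + x) ^+ (2 * E) < _).
  rewrite mulrCA ler_wpM2l ?exprn_ge0 ?addr_ge0 ?mulr_ge0 ?(ltW x0) // exprM.
  apply: le_trans (_ : (1 + x / 2) ^+ E * (w ^+ y) ^+ E <= _).
    by rewrite ler_wpM2l // exprn_ge0 // addr_ge0 // divr_ge0 // ltW.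
  rewrite -exprMn mulrC lerXn2r // nnegrE.
    by rewrite mulr_ge0 ?addr_ge0 ?divr_ge0 ?exprn_ge0 ?(ltW x0) //; lra.
  by rewrite exprn_ge0 // addr_ge0 // ltW.
rewrite ltr_pM2r // ltr_eXn2l //; lra.
Qed.

End Numerics.

(** This [z] keeps the moment factor below 2 while [z ^+ 2 >= N]. With [2 * D + 1] allowed thin
    coordinates the right side is at least [N ^ D.+1], which beats [2 * D * N ^ D]. *)
Lemma base_bound (R : realFieldType) (D m N : nat) : (0 < m)%N ->
  ((2 * m) ^ 2 <= N)%N -> (2 * D < N)%N ->
  let z : R := N%:R / (2 * m)%:R in
  1 <= z /\ (D * N ^ D)%:R * (1 + (z - 1) / N%:R) ^+ m < z ^+ (2 * D + 1).+1.
Proof.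
move=> m0 mN DN z; have M0 : 0 < (2 * m)%:R :> R by rewrite ltr0n muln_gt0.
have N0 : 0 < N%:R :> R by rewrite ltr0n; lia.
have z1 : 1 <= z.
  rewrite ler_pdivlMr // mul1r ler_nat; apply: leq_trans mN.
  by rewrite expnS leq_pmulr // expn_gt0 muln_gt0 m0.
have hz2 : N%:R <= z ^+ 2.
  rewrite expr_div_n ler_pdivlMr ?exprn_gt0 // -!natrX -natrM ler_nat.
  by rewrite -(mulnn N) leq_mul2l mN orbT.
split=> //; have hu : (1 + (z - 1) / N%:R) ^+ m <= 2.
  apply: le_trans (_ : (1 + (2 * m)%:R^-1) ^+ m <= _).
    rewrite lerXn2r ?nnegrE ?addr_ge0 ?divr_ge0 ?subr_ge0 ?invr_ge0 ?(ltW N0) ?(ltW M0) //.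
    rewrite lerD2l ler_pdivrMr // mulrC; apply: le_trans (_ : z <= _); [lra|by []].
  have := @expr_inv_bound R (2 * m)%:R^-1 m.
  have -> : m%:R * (2 * m)%:R^-1 = 2^-1 :> R.
    by rewrite natrM invfM mulrCA mulfV ?mulr1 // gt_eqF // ltr0n.
  move=> h; have {h} : (1 + (2 * m)%:R^-1) ^+ m * (1 - 2^-1) <= 1 :> R.
    by apply: h; rewrite ?invr_ge0 ?(ltW M0) //; lra.
  lra.
apply: le_lt_trans (_ : (2 * D * N ^ D)%:R < _).
  by rewrite -[(2 * D * _)%N]mulnA [leRHS]natrM mulrC ler_wpM2r.
apply: lt_le_trans (_ : N%:R ^+ D.+1 <= _).
  by rewrite exprS -natrX -natrM ltr_nat ltn_pmul2r // expn_gt0; lia.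
have -> : (2 * D + 1).+1 = (2 * D.+1)%N by lia.
by rewrite exprM lerXn2r // nnegrE ?exprn_ge0 // ltW //; lra.
Qed.

Lemma leq_expl (D m n : nat) : (m <= n)%N -> (m ^ D <= n ^ D)%N.
Proof. by case: D => // D mn; rewrite leq_exp2r. Qed.

(** The left side is exponential in [j], the right side doubly exponential. *)
Lemma step_size (D n a h j M : nat) : (M <= 2 ^ a)%N -> (3 + D * (7 + a) <= h)%N ->
  (n <= 16 * (8 ^ j * M))%N -> (n ^ D * 8 <= 2 ^ (h * 2 ^ j))%N.
Proof.
move=> Ma ha hn; apply: (@leq_trans (2 ^ (D * (4 + 3 * j + a) + 3))).
  rewrite expnD leq_mul2r /= [(D * _)%N]mulnC expnM leq_expl //.
  have -> : (2 ^ (4 + 3 * j + a) = 16 * (8 ^ j * 2 ^ a))%N by rewrite 2!expnD expnM mulnA.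
  by apply: leq_trans hn _; rewrite !leq_mul.
rewrite leq_exp2l //.
have : (j < 2 ^ j)%N by exact: ltn_expl.
nia.
Qed.

Lemma exact_base_eq (F : finFieldType) (D n N B s kap : nat)
    (k : 'I_D -> nat) (U : {set grid D n}) : n = (N * B)%N ->
  (kap + (2 * D + 1) <= B)%N -> (0 < kap)%N -> (0 < s)%N -> (B <= #|F|)%N ->
  ((2 * (B ^ D * s)) ^ 2 <= N)%N -> (2 * D < N)%N ->
  (forall i, (k i <= N * kap)%N) -> line_closed s U ->
  exists2 g : {ffun 'I_D -> 'M[F]_n}, forall i, g i \in unitmx & exact (code k g) U.
Proof.
case: N B => [|A] [|B] en kq kap0 s0 BF mN DN; subst n => //.
  by lia.
have m0 : (0 < B.+1 ^ D * s)%N by rewrite muln_gt0 expn_gt0.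
have [z1 hz] := @base_bound rat D _ _ m0 mN DN => kk Us.
by apply: (@exact_base F D A B s (2 * D + 1) kap rat _ k U kq _ z1 BF hz) => //; lia.
Qed.

(** The field size demanded by [good_tuple_exists], with [kap] replaced by [n]. *)
Definition field_bound (D n : nat) : nat := n.+1 ^ D * 2 ^ (n ^ D) * (2 * n ^ D) + D * n.

Lemma leq_field_bound (D m n : nat) : (m <= n)%N -> (field_bound D m <= field_bound D n)%N.
Proof.
by move=> mn; rewrite /field_bound leq_add ?leq_mul ?leq_exp2l ?leq_expl.
Qed.

(** * The tower of lengths *)

Section Tower.
Variables (F : finFieldType) (D B N kap a h : nat).
Hypotheses (D0 : (0 < D)%N) (kap0 : (0 < kap)%N) (kapB : (kap + (2 * D + 1) <= B)%N) (h0 : (0 < h)%N).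
Hypotheses (hN : ((2 * (B ^ D * (128 * h))) ^ 2 <= N)%N) (DN : (2 * D < N)%N).
Hypotheses (hNB : (N * B <= 2 ^ a)%N) (ha : (3 + D * (7 + a) <= h)%N).

Let len j := (8 ^ j * (N * B))%N.
(* The term 4 ^ j is the fluctuation allowance: sparse j / len j decreases with j
   by a factor of at most 2 in total. *)
Let sparse j := (64 * h * (8 ^ j + 4 ^ j))%N.

(** One step with eight blocks. Lengths up to [16 * len j] are allowed so that the last step can
    reach an [n] outside the tower. *)
Lemma exact_step8 j (n s : nat) (k : 'I_D -> nat) (U : {set grid D n}) :
  good_tuple F D (len j) (sparse j) (8 ^ j * (N * kap)) ->
  (8 * len j <= n <= 16 * len j)%N -> (forall i, (k i <= 8 * (8 ^ j * (N * kap)))%N) ->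
  line_closed s U -> (s <= sparse j.+1)%N ->
  exists2 g : {ffun 'I_D -> 'M[F]_n}, forall i, g i \in unitmx & exact (code k g) U.
Proof.
move=> good /andP[n8 n16] kk Us ss.
have B0 : (0 < B)%N by lia.
have sl : (sparse j < len j)%N.
  rewrite /sparse /len; have : (128 * h < N)%N.
    have : (0 < B ^ D)%N by rewrite expn_gt0 B0.
    by move: hN; set b := (B ^ D)%N; nia.
  move=> hN1; apply: (@leq_ltn_trans (8 ^ j * (128 * h))).
    have : (4 ^ j <= 8 ^ j)%N by exact: leq_expl.
    by clear; move: (8 ^ j)%N (4 ^ j)%N => p r; nia.
  by rewrite ltn_pmul2l ?expn_gt0 //; apply: leq_trans hN1 (leq_pmulr _ B0).
move E : (len j) good n8 n16 sl => l; case: l E => // l E good n8 n16 sl.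
(* [step_bound] is used with [y = 2 ^ j], so that [sparse j = 64 * h * (y ^ 3 + y ^ 2)]. *)
pose x : rat := (64 * 2 ^ j)%:R^-1.
have x0 : 0 < x by rewrite invr_gt0 ltr0n muln_gt0 expn_gt0.
apply: (@exact_step F D n 7 l s (sparse j) (8 ^ j * (N * kap)) _ (1 + 8 * x) k U n8 _ _ _ _ good kk Us).
- by rewrite -E /len leq_mul2l leq_mul2l; apply/orP; right; apply/orP; right; lia.
- by rewrite /sparse muln_gt0 addn_gt0 !muln_gt0 h0 expn_gt0 /=; rewrite ltnS in sl.
- lra.
have -> : (1 + 8 * x - 1) / 8%:R = x by field.
have e8 : (8 ^ j = (2 ^ j) ^ 3)%N by rewrite -expnM mulnC expnM.
have e4 : (4 ^ j = (2 ^ j) ^ 2)%N by rewrite -expnM mulnC expnM.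
have hsp : sparse j.+1 = (64 * h * (8 * (2 ^ j) ^ 3 + 4 * (2 ^ j) ^ 2))%N.
  by rewrite /sparse 2!expnS e8 e4.
have hsp' : sparse j = (64 * h * ((2 ^ j) ^ 3 + (2 ^ j) ^ 2))%N by rewrite /sparse e8 e4.
apply: le_lt_trans (_ : (n ^ D * 8)%:R * (1 + x) ^+ sparse j.+1 < _).
  by rewrite ler_wpM2l // ler_weXn2l // lerDl ltW.
rewrite hsp hsp'; apply: step_bound => //; first by rewrite expn_gt0.
by apply: (step_size (M := (N * B)%N) hNB ha); rewrite -/(len j) E.
Qed.

(** At each level the previous one gives a tuple depending on [U], and [good_tuple_exists] replaces
    it by a common one. *)
Lemma good_tower j : (field_bound D (len j) < #|F|.-1)%N ->
  good_tuple F D (len j) (sparse j) (8 ^ j * (N * kap)).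
Proof.
have B0 : (0 < B)%N by lia.
have N0 : (0 < N)%N by lia.
have fin j' s : (field_bound D (len j') < #|F|.-1)%N ->
   (forall (k : 'I_D -> nat) (U : {set grid D (len j')}),
     (forall i, (k i <= 8 ^ j' * (N * kap))%N) -> line_closed s U ->
     exists2 g : {ffun 'I_D -> 'M[F]_(len j')}, forall i, g i \in unitmx & exact (code k g) U) ->
   good_tuple F D (len j') s (8 ^ j' * (N * kap)).
  move=> hq hex; apply: good_tuple_exists hex _; apply: leq_ltn_trans hq.
  have hl : (8 ^ j' * (N * kap) <= len j')%N by rewrite !leq_mul2l; lia.
  by rewrite /field_bound leq_add // !leq_mul // leq_expl.
elim: j => [|j IH] hq.
  have s0 : sparse 0 = (128 * h)%N by rewrite /sparse !expn0; lia.
  rewrite s0; apply: fin => // k U kk Us.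
  apply: (@exact_base_eq F D (len 0) N B (128 * h) kap k U _ kapB kap0 _ _ hN DN _ Us).
  - by rewrite /len mul1n.
  - by rewrite muln_gt0 h0.
  - have : (B <= len 0)%N by rewrite /len mul1n; nia.
    have : (len 0 <= field_bound D (len 0))%N by rewrite /field_bound; nia.
    by lia.
  - by move=> i; have := kk i; rewrite mul1n.
apply: fin => // k U kk Us.
have l8 : len j.+1 = (8 * len j)%N by rewrite /len expnS -mulnA.
apply: (exact_step8 (j := j)) Us _ => //.
- by apply: IH; apply: leq_ltn_trans hq; apply: leq_field_bound; rewrite l8; lia.
- by rewrite l8; lia.
- by move=> i; apply: leq_trans (kk i) _; rewrite expnS -mulnA.
Qed.
End Tower.

Lemma affine_le_exp2 (c d : nat) : exists u, (c + d * u <= 2 ^ u)%N.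
Proof.
pose v := (c + 2 * d)%N; exists (2 * v)%N.
have : (v < 2 ^ v)%N by exact: ltn_expl.
by rewrite mul2n -addnn expnD; move: (2 ^ v)%N => p; rewrite /v; nia.
Qed.

(** The requirements are circular, as [h] must exceed a multiple of [a] and [2 ^ a] must exceed a
    power of [h]. Taking [h = 2 ^ u] makes [a] affine in [u], so a suitable [u] exists. *)
Lemma tower_parameters (D e : nat) : (0 < D)%N -> (1 < e)%N ->
  exists h a N0 : nat, let B := (e * (2 * D + 1))%N in
    [/\ (0 < h)%N, ((2 * (B ^ D * (128 * h))) ^ 2 <= N0)%N, (2 * D + e <= N0)%N,
        (8 * N0 * B <= 2 ^ a)%N & (3 + D * (7 + a) <= h)%N].
Proof.
move=> D0 e1; pose B := (e * (2 * D + 1))%N; pose b := (B * (2 * D + 1))%N.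
have [u hu] := affine_le_exp2 (3 + D * (26 + b)) (2 * D).
exists (2 ^ u)%N, (3 + 2 * (8 + u) + b)%N, ((2 * (B ^ D * (128 * 2 ^ u))) ^ 2)%N; split=> //.
- by rewrite expn_gt0.
- have B0 : (0 < B)%N by rewrite /B muln_gt0 addn1 andbT ltnW.
  have h1 : (2 * D + e <= B)%N by rewrite /B; clear -e1; nia.
  have h2 : (B <= B ^ D)%N by rewrite -{1}(expn1 B) leq_pexp2l.
  apply: leq_trans h1 (leq_trans h2 _); rewrite mulnCA expnS expn1.
  by rewrite -mulnA leq_pmulr // !muln_gt0 !expn_gt0 B0.
- have -> : (2 * (B ^ D * (128 * 2 ^ u)) = B ^ D * 2 ^ (8 + u))%N by rewrite expnD; ring.
  have eB : (B ^ (2 * D + 1) = (B ^ D) ^ 2 * B)%N by rewrite addn1 expnSr [(2 * D)%N]mulnC expnM.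
  have eP : (2 ^ (3 + 2 * (8 + u)) = 8 * (2 ^ (8 + u)) ^ 2)%N.
    by rewrite expnD [(2 * _)%N]mulnC expnM.
  rewrite [(2 ^ (_ + b))%N]expnD eP.
  have eL r p : (8 * (r * p) ^ 2 * B = 8 * p ^ 2 * (r ^ 2 * B))%N by ring.
  rewrite eL -eB leq_mul2l; apply/orP; right.
  by rewrite /b expnM leq_expl // ltnW // ltn_expl.
- by apply: leq_trans hu; apply/eq_leq; rewrite -/b; ring.
Qed.

(** [N] is a leading part of [M] in base 8, cut so that it stays in a range independent of [M]. *)
Lemma base8_expansion (N0 M : nat) : (0 < N0)%N -> (N0 <= M)%N ->
  exists j N : nat, [/\ (N0 <= N < 8 * N0)%N, (8 ^ j * N <= M)%N & (M < 8 ^ j * N.+1)%N].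
Proof.
move=> N00; elim/ltn_ind: M => M IH MN.
have [lt|ge] := ltnP M (8 * N0); first by exists 0, M; rewrite MN lt !mul1n.
have [||j [N [h1 h2 h3]]] := IH (M %/ 8)%N; [lia|lia|].
exists j.+1, N; rewrite h1 expnS; split=> //; move: h2 h3; move: (8 ^ j)%N => p; nia.
Qed.

(** A field above the threshold for [n] has room for a common tuple at the block length [l]. *)
Lemma leq_field_boundX (D l n : nat) : (0 < D)%N -> (0 < l)%N -> (8 * l <= n)%N ->
  ((field_bound D l).+1 < n ^ D * 2 ^ (n ^ D).+1)%N.
Proof.
move=> D0 l0 ln; rewrite /field_bound; set N := (n ^ D)%N; set P := (l ^ D)%N.
have P0 : (0 < P)%N by rewrite expn_gt0 l0.
have NP : (8 * P <= N)%N.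
  apply: (@leq_trans (8 ^ D * P)); last by rewrite -expnMn leq_expl.
  by rewrite leq_mul2r -{1}(expn1 8) leq_pexp2l // orbT.
have nN : (n <= N)%N by rewrite -{1}(expn1 n) leq_pexp2l //; lia.
have l1 : (l.+1 ^ D <= N)%N by rewrite leq_expl //; lia.
have DN : (D < N)%N.
  apply: leq_trans (_ : (2 ^ D <= _)%N); first exact: ltn_expl.
  by rewrite leq_expl //; lia.
have h1 : (2 ^ P * (2 * P) <= 2 ^ N)%N.
  apply: (@leq_trans (2 ^ P * (2 ^ P.+1))).
    by rewrite leq_mul2l expnS leq_mul2l [(P <= _)%N]ltnW ?orbT // ltn_expl.
  by rewrite -expnD leq_exp2l //; lia.
have h2 : (N < 2 ^ N)%N by exact: ltn_expl.
rewrite expnS -mulnA; have := leq_mul l1 h1; set X := (_ * (2 ^ P * _))%N => hX.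
apply: (@leq_ltn_trans (N * 2 ^ N + (D * l).+1)); first by rewrite -addnS leq_add2r.
move: h2; move: (2 ^ N)%N => Q; nia.
Qed.

(** Of the slack [2 / e] in the rate, one share [1 / e] is spent on the thin coordinates at constant
    length, the other on rounding [n] to eight blocks of tower length. *)
Lemma exact_of_line_closed (D e : nat) : (0 < D)%N -> (1 < e)%N ->
  exists2 Gam : nat, (0 < Gam)%N & forall n, (Gam <= n)%N ->
    exists s, [/\ (0 < s)%N, (n <= Gam * s)%N &
      forall (F : finFieldType) (k : 'I_D -> nat) (U : {set grid D n}),
        (n ^ D * 2 ^ (n ^ D).+1 < #|F|)%N -> (forall i, (e * k i <= (e - 2) * n)%N) ->
        line_closed s U ->
        exists2 g : {ffun 'I_D -> 'M[F]_n}, forall i, g i \in unitmx & exact (code k g) U].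
Proof.
move=> D0 e1; have [h [a [N0 []]]] := tower_parameters D0 e1.
set q := (2 * D + 1)%N; set B := (e * q)%N => h0 hN DeN hNB ha.
have q0 : (0 < q)%N by rewrite /q addn1.
have B0 : (0 < B)%N by rewrite /B muln_gt0 q0 andbT ltnW.
have eB : B = (e * q)%N by [].
clearbody B.
exists (64 * B * N0)%N => [|n hn]; first by rewrite !muln_gt0 B0 /=; lia.
have [||j [N [/andP[N1 N2] hM1 hM2]]] := @base8_expansion N0 (n %/ (8 * B)).
- lia.
- rewrite leq_divRL ?muln_gt0 ?B0 //; nia.
pose kap := ((e - 1) * q)%N.
have kapB : (kap + q <= B)%N by rewrite /kap eB; nia.
have kap0 : (0 < kap)%N by rewrite /kap muln_gt0 q0; lia.
have lo : (8 * (8 ^ j * (N * B)) <= n)%N.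
  move: hM1; rewrite leq_divRL ?muln_gt0 ?B0 //; move: (8 ^ j)%N => p; nia.
have hi : (n < 8 * (8 ^ j * (N.+1 * B)))%N.
  move: hM2; rewrite ltn_divLR ?muln_gt0 ?B0 //; move: (8 ^ j)%N => p; nia.
have p0 : (0 < 8 ^ j)%N by rewrite expn_gt0.
exists (64 * h * (8 ^ j.+1 + 4 ^ j.+1))%N; split=> [||F k U hF hk Us].
- by rewrite !muln_gt0 h0 addn_gt0 expn_gt0.
- apply: leq_trans (ltnW hi) _; rewrite expnS.
  apply: (@leq_trans (64 * B * N0 * 8 ^ j)).
    have -> : (64 * B * N0 * 8 ^ j = 8 * (8 ^ j * (8 * N0 * B)))%N by ring.
    by rewrite !leq_mul.
  rewrite leq_mul2l; apply/orP; right.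
  apply: leq_trans (_ : _ <= 8 * 8 ^ j + 4 ^ j.+1)%N _; last by rewrite leq_pmull // muln_gt0 h0.
  by apply: leq_trans (leq_addr _ _); rewrite leq_pmull.
have hN' : ((2 * (B ^ D * (128 * h))) ^ 2 <= N)%N by exact: leq_trans N1.
have DN : (2 * D < N)%N by lia.
have hNB' : (N * B <= 2 ^ a)%N.
  by apply: leq_trans hNB; rewrite leq_mul2r [(N <= _)%N]ltnW ?orbT.
apply: (@exact_step8 F D B N kap a h D0 kap0 kapB h0 hN' DN hNB' ha j) Us _ => //.
- apply: (good_tower D0 kap0 kapB h0 hN' DN hNB' ha).
  have l0 : (0 < 8 ^ j * (N * B))%N by rewrite !muln_gt0 p0 B0; lia.
  have := leq_field_boundX D0 l0 lo; lia.
- rewrite lo /=; apply: leq_trans (ltnW hi) _.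
  have -> : (16 * (8 ^ j * (N * B)) = 8 * (8 ^ j * (2 * N * B)))%N by ring.
  by rewrite !leq_mul //; lia.
- move=> i; rewrite -(leq_pmul2l (_ : 0 < e)%N); last by lia.
  apply: leq_trans (hk i) _; apply: leq_trans (leq_mul (leqnn _) (ltnW hi)) _.
  rewrite /kap eB; move: (8 ^ j)%N => p.
  (* Rounding loses less than one unit of [N], and [N] is at least [e - 2]. *)
  have hN2 : ((e - 2) * N.+1 <= (e - 1) * N)%N.
    have -> : (e - 1 = (e - 2).+1)%N by lia.
    by rewrite mulnS mulSn leq_add2r; lia.
  move: hN2; move: (e - 2)%N (e - 1)%N => e2 e1' hN2.
  have -> : (e2 * (8 * (p * (N.+1 * (e * q)))) = 8 * e * p * q * (e2 * N.+1))%N by ring.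
  have -> : (e * (8 * (p * (N * (e1' * q)))) = 8 * e * p * q * (e1' * N))%N by ring.
  by rewrite leq_mul2l hN2 orbT.
Qed.

(** * Closure of a support *)

Section Closure.
Variables (F : finFieldType) (D n h : nat).
Hypotheses (nF : (n.+1 <= #|F|)%N) (hn : (0 < h <= n.+1)%N).
Variable S : {set grid D n.+1}.

(* U is the zero set of all functions of degree < h in each variable vanishing on
   S. Such functions interpolate arbitrary values on boxes of side h, so a box
   contains at most |S| points of U; average over the cyclic translates. *)
Lemma low_degree_closure : exists U : {set grid D n.+1},
  [/\ S \subset U, line_closed h U & (#|U| * h ^ D <= n.+1 ^ D * #|S|)%N].
Proof.
have [al al_inj] := inj_of_card nF; case/andP: hn => h0 hle.
pose G : 'M[F]_(h, n.+1) := \matrix_(i, b) al b ^+ i.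
pose lowdeg (x : tensor F D n.+1) := [forall i, [forall g, (restr x i g <= G)%MS]].
pose U := [set v | [forall x : tensor F D n.+1,
   lowdeg x && [forall s in S, x s == 0] ==> (x v == 0)]].
have UP v x : v \in U -> lowdeg x -> (forall s, s \in S -> x s = 0) -> x v = 0.
  rewrite inE => /forallP/(_ x)/implyP vU xl xS; apply/eqP/vU; rewrite xl /=.
  by apply/forallP => s; apply/implyP => sS; rewrite xS.
exists U; split.
- apply/subsetP => s sS; rewrite inE; apply/forallP => x; apply/implyP => /andP[_ /forallP hx].
  exact: implyP (hx s) sS.
(* A polynomial of degree below [h] vanishing at more than [h] points of a line vanishes on the
   whole line. *)
- move=> i v; apply: contraR; rewrite -ltnNge => lt; apply/fulllineP => a.
  rewrite inE; apply/forallP => x; apply/implyP => /andP[xl /forallP xS].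
  have /submxP[w ew] : (restr x i v <= G)%MS by have /forallP/(_ i)/forallP := xl.
  suff w0 : w = 0.
    by have := congr1 (fun c : 'rV_n.+1 => c 0 a) ew; rewrite w0 mul0mx !mxE => ->.
  apply: (row_poly_zeros al_inj _ (ltnW lt)) => [j|b].
    by rewrite leqNgt ltn_ord.
  rewrite inE => bU.
  rewrite -ew mxE; apply: (UP _ x) => // s sS.
  by apply/eqP; exact: implyP (xS s) sS.
- pose pt (y : grid D n.+1) (t : grid D h) : grid D n.+1 := [ffun i => y i + inord (t i)].
  have inord_inj (j j' : 'I_h) : inord j = inord j' :> 'I_n.+1 -> j = j'.
    move/(congr1 val); rewrite /= !inordK ?(leq_trans (ltn_ord _)) // => e; exact: val_inj.
  (* A Lagrange basis for the [h] cyclically consecutive coordinates starting at [b]. *)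
  have interp (b : 'I_n.+1) : exists L : 'I_h -> 'rV[F]_n.+1,
      forall j, (L j <= G)%MS /\ forall j' : 'I_h, L j 0 (b + inord j') = (j == j')%:R.
    pose X := colsub (fun j : 'I_h => b + inord j) G.
    have Xu : X \in unitmx.
      rewrite -row_free_unit; apply: inj_row_free => w wX.
      apply: (row_poly_zeros (Z := [set b + inord j | j : 'I_h]) (k := h) al_inj).
        by move=> i; rewrite leqNgt ltn_ord.
        by rewrite card_imset ?card_ord // => j j' /addrI /inord_inj.
      move=> _ /imsetP[j _ ->]; transitivity ((w *m X) 0 j); last by rewrite wX mxE.
      by rewrite !mxE; apply: eq_bigr => i _; rewrite !mxE.
    exists (fun j => row j (invmx X) *m G) => j; split; first exact: submxMl.
    move=> j'; transitivity ((invmx X *m X) j j'); last by rewrite mulVmx // mxE.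
    by rewrite !mxE; apply: eq_bigr => i _; rewrite !mxE.
  have [L hL] := fin_all_exists interp.
  have box y : (#|[set t | pt y t \in U]| <= #|S|)%N.
    pose T := {t : grid D h | pt y t \in U}.
    pose x (f : {ffun T -> F}) : tensor F D n.+1 :=
      [ffun v : grid D n.+1 => \sum_t f t * \prod_i L (y i) (val t i) 0 (v i)].
    have xl f : lowdeg (x f).
      apply/forallP => i; apply/forallP => g.
      have -> : restr (x f) i g = \sum_t (f t * \prod_(j | j != i) L (y j) (val t j) 0 (g j)) *:
          L (y i) (val t i).
        apply/rowP => a; rewrite !mxE ffunE summxE; apply: eq_bigr => t _; rewrite mxE.
        rewrite (bigD1 i) //= set_coord_eq mulrCA [RHS]mulrC; congr (_ * (_ * _)).
        by apply: eq_bigr => j ji; rewrite set_coord_neq.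
      by apply: summx_sub => t _; rewrite scalemx_sub //; have [] := hL (y i) (val t i).
    have xpt f t : x f (pt y (val t)) = f t.
      rewrite ffunE (bigD1 t) //= [X in _ * X]big1 ?mulr1 ?big1 ?addr0 // => [t' tt'|i _].
        have /existsP[i hi] : [exists i, val t' i != val t i].
          rewrite -negb_forall; apply: contra tt' => /forallP e.
          by apply/eqP/val_inj/ffunP => i; apply/eqP.
        rewrite (bigD1 i) //= ffunE; have [_ ->] := hL (y i) (val t' i).
        by rewrite (negbTE hi) mul0r mulr0.
      by rewrite ffunE; have [_ ->] := hL (y i) (val t i); rewrite eqxx.
    (* An interpolant vanishing on [S] vanishes on [U], so its values on [S] determine the data on
       [T]; counting functions gives at most [#|S|] points. *)
    pose r (f : {ffun T -> F}) : {ffun {s | s \in S} -> F} := [ffun s => x f (val s)].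
    have r_inj : injective r.
      move=> f f' /ffunP e; apply/ffunP => t.
      have xB : x (f - f') = x f - x f'.
        apply/ffunP => v; rewrite !ffunE -sumrB; apply: eq_bigr => t' _.
        by rewrite !ffunE mulrBl.
      apply/eqP; rewrite -subr_eq0; apply/eqP.
      have -> : f t - f' t = (f - f') t by rewrite !ffunE.
      rewrite -xpt; apply: UP (valP t) (xl _) _ => s sS.
      have -> : x (f - f') s = x f s - x f' s by rewrite xB; move: (x f) (x f') => p p'; rewrite !ffunE.
      have := e (exist _ s sS); rewrite ffunE [RHS]ffunE /= => ->; exact: subrr.
    have := leq_card r r_inj; rewrite !card_ffun leq_exp2l; last first.
      exact: card_finNzRing_gt1.
    by rewrite !card_sig; congr (_ <= _)%N; apply: eq_card => t; rewrite !inE.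
  have -> : (#|U| * h ^ D = \sum_y #|[set t | pt y t \in U]|)%N.
    transitivity (\sum_(t : grid D h) #|U|)%N.
      by rewrite sum_nat_const card_ffun !card_ord mulnC.
    transitivity (\sum_(t : grid D h) \sum_y (pt y t \in U : nat))%N.
      apply: eq_bigr => t _.
      have pt_inj : injective (fun y => pt y t).
        by move=> y y' /ffunP e; apply/ffunP => i; have := e i; rewrite !ffunE => /addIr.
      rewrite -(card_preimset U pt_inj) -sum1_card big_mkcond; apply: eq_bigr => y _.
      by rewrite inE; case: (_ \in U).
    rewrite exchange_big; apply: eq_bigr => y _; rewrite -sum1_card [RHS]big_mkcond.
    by apply: eq_bigr => t _; rewrite inE; case: (_ \in U).
  apply: leq_trans (leq_sum _ (fun y _ => box y)) _.
  by rewrite sum_nat_const card_ffun !card_ord.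
Qed.

End Closure.

(** * From exactness to expansion *)

Section Expansion.
Variables (F : finFieldType) (D n : nat).
Implicit Types (U : {set grid D n}) (x : tensor F D n) (M : 'I_D -> 'M[F]_n).

Definition row_space (M : 'M[F]_n) : {set 'rV[F]_n} := [set v | (v <= M)%MS].
Definition row_spaces M : {ffun 'I_D -> {set 'rV[F]_n}} := [ffun i => row_space (M i)].

Lemma in_tensor_code M i x : (x \in tensor_code i (row_spaces M i)) <-> tcode i (M i) x.
Proof.
rewrite inE; split=> [/forallP h g|h]; first by have := h g; rewrite ffunE inE.
by apply/forallP => g; rewrite ffunE inE.
Qed.

Lemma line_set_coord i (v : grid D n) a : line i (set_coord v i a) = line i v.
Proof.
apply/setP => w; rewrite !inE; apply: eq_forallb => j.
by case: (eqVneq j i) => // ji; rewrite set_coord_neq.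
Qed.

Lemma mem_line i (v w : grid D n) : w \in line i v -> w = set_coord v i (w i).
Proof.
rewrite inE => /forallP h; apply/ffunP => j; rewrite ffunE; case: eqP => [->//|/eqP ji].
exact/eqP/(implyP (h j)).
Qed.

(** The counted lines are disjoint, lie inside [U] and have [n] points each. *)
Lemma axis_weight_le U i x : (forall v, x v != 0 -> fullline U i v) ->
  (axis_weight i x * n <= #|U|)%N.
Proof.
move=> hx; rewrite /axis_weight; set A := [set l in _ | _].
apply: (@leq_trans (\sum_(l in A) #|[set v in U | line i v == l]|)).
  rewrite -sum_nat_const; apply: leq_sum => l; rewrite !inE => /andP[/imsetP[g _ ->]].
  case/existsP => w /andP[wg /hx /fulllineP wU].
  have inj : injective (set_coord w i).
    by move=> a b /(congr1 (fun v : grid D n => v i)); rewrite !set_coord_eq.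
  rewrite -{1}(card_ord n) -(card_imset _ inj); apply: subset_leq_card.
  apply/subsetP => _ /imsetP[a _ ->]; rewrite inE wU /= line_set_coord.
  by rewrite (mem_line wg) line_set_coord.
rewrite -sum1_card [leqRHS](partition_big (line i) predT) //=.
rewrite [leqRHS](bigID (mem A)) /=; apply: leq_trans (leq_addr _ _).
by apply: leq_sum => l _; rewrite -sum1_card; apply: eq_leq; apply: eq_bigl => v; rewrite inE.
Qed.

Lemma axis_weight_grid i x : (axis_weight i x * n <= n ^ D)%N.
Proof.
apply: leq_trans (_ : #|[set: grid D n]| <= _)%N; last by rewrite cardsT card_ffun !card_ord.
by apply: axis_weight_le => v _; apply/fulllineP => a; rewrite inE.
Qed.

Lemma axis_weight0 i : axis_weight i (0 : tensor F D n) = 0%N.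
Proof.
rewrite /axis_weight (_ : [set l in _ | _] = set0) ?cards0 //.
apply/setP => l; rewrite !inE; apply/negP => /andP[_ /existsP[w]].
by rewrite ffunE eqxx andbF.
Qed.

Lemma product_expandingP (R : realType) (K : nat) M : (0 < K)%N ->
  (forall a : 'I_D -> tensor F D n, (forall i, tcode i (M i) (a i)) -> \sum_i a i != 0 ->
     exists a' : 'I_D -> tensor F D n, [/\ forall i, tcode i (M i) (a' i),
       \sum_i a i = \sum_i a' i &
       ((\sum_i axis_weight i (a' i)) * n <= K * hweight (\sum_i a i)%R)%N]) ->
  product_expanding (K%:R^-1 : R) (row_spaces M).
Proof.
move=> K0 h; apply/forallP => c; apply/implyP => /existsP[a0 /andP[/forallP ha /eqP ec]].
have {}ha i : tcode i (M i) (a0 i) by apply/in_tensor_code/ha.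
have [a' [ha' ec' hw]] : exists a' : 'I_D -> tensor F D n, [/\ forall i, tcode i (M i) (a' i),
    c = \sum_i a' i & ((\sum_i axis_weight i (a' i)) * n <= K * hweight c)%N].
  have [c0|c0] := eqVneq c 0; last first.
    by rewrite ec in c0 *; exact: h.
  exists (fun=> 0); split=> [i g||]; last first.
  - by rewrite big1 // => i _; rewrite axis_weight0.
  - by rewrite big1.
  suff -> : restr (0 : tensor F D n) i g = 0 by exact: sub0mx.
  by apply/rowP => b; rewrite !mxE ffunE.
apply/existsP; exists [ffun i => a' i]; apply/and3P; split.
- by apply/forallP => i; apply/in_tensor_code; rewrite ffunE.
- by rewrite ec'; apply/eqP/eq_bigr => i _; rewrite ffunE.
rewrite /naxis_weight /nweight card_ffun !card_ord.
under eq_bigr do rewrite ffunE.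
rewrite -mulr_suml -natr_sum; set W := (\sum_i _)%N in hw *.
have KR : 0 < K%:R :> R by rewrite ltr0n.
have [n0|n0] := posnP n.
  have -> : W = 0%N.
    rewrite /W big1 // => i _; have gE (v : grid D n) : False by have := v i; rewrite n0 => -[].
    by apply/eqP; rewrite cards_eq0; apply/eqP/setP => l; rewrite !inE; apply/negP
      => /andP[/imsetP[g _ _] _]; exact: gE g.
  by rewrite mul0r mulr0 divr_ge0.
have [D0|D0] := posnP D.
  have -> : W = 0%N by rewrite /W big1 // => i; have := ltn_ord i; rewrite {2}D0.
  by rewrite mul0r mulr0 divr_ge0.
have nd : 0 < (n ^ D.-1)%:R :> R by rewrite ltr0n expn_gt0 n0.
have nn : 0 < (n ^ D)%:R :> R by rewrite ltr0n expn_gt0 n0.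
rewrite mulrA ler_pdivrMr // [leRHS]mulrAC ler_pdivlMr // -mulrA ler_pdivrMl //.
rewrite -!natrM ler_nat -{1}(prednK D0) expnS.
apply: leq_trans (_ : (W * n * n ^ D.-1 <= _)%N); first by apply: eq_leq; ring.
by apply: leq_trans (leq_mul hw (leqnn _)) _; apply: eq_leq; ring.
Qed.

End Expansion.

(** * Random code tuples *)

Lemma sum_le_card (D c n : nat) (w : 'I_D -> nat) :
  (forall i, (w i * n <= c)%N) -> ((\sum_i w i) * n <= D * c)%N.
Proof.
move=> h; rewrite big_distrl /=; apply: leq_trans (leq_sum _ (fun i _ => h i)) _.
by rewrite sum_nat_const card_ord.
Qed.

Lemma sum_axis_weight_grid (F : finFieldType) (D n : nat) (a : 'I_D -> tensor F D n) :
  ((\sum_i axis_weight i (a i)) * n <= D * n ^ D)%N.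
Proof. by apply: sum_le_card => i; exact: axis_weight_grid. Qed.

(** At bounded length any decomposition will do, since a nonzero word has weight at least 1. *)
Lemma expanding_small (F : finFieldType) (R : realType) (D n Gam : nat) (M : 'I_D -> 'M[F]_n) :
  (0 < D)%N -> (0 < Gam)%N -> (n <= Gam)%N ->
  product_expanding ((2 * D * Gam ^ D)%:R^-1 : R) (row_spaces M).
Proof.
move=> D0 G0 nG; apply: product_expandingP => [|a ha c0].
  by rewrite !muln_gt0 D0 expn_gt0 G0.
exists a; split=> //; apply: leq_trans (sum_axis_weight_grid a) _.
have hw : (0 < hweight (\sum_i a i)%R)%N.
  rewrite card_gt0; apply: contraNneq c0 => /setP h; apply/eqP/ffunP => v.
  by have := h v; rewrite !inE => /negbFE/eqP ->; rewrite ffunE.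
apply: (@leq_trans (D * Gam ^ D)); first by rewrite leq_mul2l leq_expl ?orbT.
apply: leq_trans (leq_pmulr _ hw); rewrite leq_mul2r; apply/orP; right.
by rewrite leq_pmull.
Qed.

(** Close up the support to [U]. If [U] has less than half of the points, exactness supplies the
    decomposition; otherwise the word has weight proportional to the whole grid, and any
    decomposition will do. *)
Lemma expanding_of_exact (F : finFieldType) (R : realType) (D n Gam s : nat)
    (M : 'I_D -> 'M[F]_n) :
  (0 < D)%N -> (0 < Gam)%N -> (0 < n)%N -> (n <= #|F|)%N -> (0 < s)%N -> (n <= Gam * s)%N ->
  (forall U, line_closed s U -> (2 * #|U| < n ^ D)%N -> exact M U) ->
  product_expanding ((2 * D * Gam ^ D)%:R^-1 : R) (row_spaces M).
Proof.
case: n M => // n M D0 G0 _ nF s0 nGs hex; apply: product_expandingP => [|a ha _].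
  by rewrite !muln_gt0 D0 expn_gt0 G0.
set c := \sum_i a i; pose S := [set v | c v != 0].
have hwS : hweight c = #|S| by [].
have hh : (0 < minn s n.+1 <= n.+1)%N by rewrite leq_min s0 geq_minr.
have [U [SU Uc cU]] := low_degree_closure nF hh S.
have Us : line_closed s U.
  by move=> i v nf; apply: leq_trans (Uc i v nf) _; exact: geq_minl.
have nGh : (n.+1 <= Gam * minn s n.+1)%N.
  by rewrite minnE; nia.
have {}cU : (#|U| <= Gam ^ D * #|S|)%N.
  have p0 : (0 < minn s n.+1 ^ D)%N by rewrite expn_gt0; case/andP: hh => ->.
  rewrite -(leq_pmul2r p0); apply: leq_trans cU _.
  by rewrite mulnAC leq_mul2r -expnMn leq_expl ?orbT.
have [lt|ge] := ltnP (2 * #|U|) (n.+1 ^ D).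
  have [|a' [ha' hf ec]] := hex U Us lt a ha.
    by move=> v cv; apply: (subsetP SU); rewrite inE.
  exists a'; split=> //.
  have : ((\sum_i axis_weight i (a' i)) * n.+1 <= D * #|U|)%N.
    by apply: sum_le_card => i; apply: axis_weight_le; exact: hf.
  move/leq_trans; apply; rewrite hwS.
  apply: (@leq_trans (D * (Gam ^ D * #|S|))); first by rewrite leq_mul2l cU orbT.
  by rewrite !mulnA leq_mul2r !leq_mul2r leq_pmull ?orbT.
exists a; split=> //; apply: leq_trans (sum_axis_weight_grid a) _.
apply: (@leq_trans (D * (2 * #|U|))); first by rewrite leq_mul2l ge orbT.
rewrite hwS mulnCA -!mulnA leq_mul2l /= leq_mul2l cU orbT //.
Qed.

Section Sampling.
Variables (F : finFieldType) (D n : nat) (k : 'I_D -> nat).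
Hypothesis kn : forall i, (k i <= n)%N.
Implicit Types g : {ffun 'I_D -> 'M[F]_n}.

Definition units : {set {ffun 'I_D -> 'M[F]_n}} :=
  [set g : {ffun 'I_D -> 'M[F]_n} | [forall i, g i \in unitmx]].

Lemma code_tuple_unit g : g \in units -> row_spaces (code k g) \in code_tuples F n k.
Proof.
rewrite !inE => /forallP ug; apply/forallP => i; rewrite inE; apply/existsP.
exists (code k g i); rewrite ffunE eqxx andbT /code.
by rewrite mxrankMfree ?row_free_unit // rank_pid_mx.
Qed.

Lemma unit_of_code_tuple (Cs : {ffun 'I_D -> {set 'rV[F]_n}}) : Cs \in code_tuples F n k ->
  exists2 g, g \in units & row_spaces (code k g) = Cs.
Proof.
rewrite inE => /forallP hC.
have /fin_all_exists2[g ug hg] i : exists2 g : 'M[F]_n, g \in unitmx &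
    row_space (pid_mx (k i) *m g) = Cs i.
  have := hC i; rewrite inE => /existsP[M /andP[/eqP rM /eqP ->]].
  have [g ug eg] := pid_row_ebase M; exists g => //; rewrite rM in eg.
  by apply/setP => v; rewrite !inE eg.
exists [ffun i => g i]; first by rewrite inE; apply/forallP => i; rewrite ffunE.
by apply/ffunP => i; rewrite ffunE /code ffunE hg.
Qed.

Definition fibre (Cs : {ffun 'I_D -> {set 'rV[F]_n}}) : {set {ffun 'I_D -> 'M[F]_n}} :=
  [set g in units | row_spaces (code k g) == Cs].

(** Right multiplication by a tuple representing [Cs] maps the standard fibre onto that of [Cs]; so
    uniform invertible tuples induce uniform codes. *)
Lemma card_fibre Cs : Cs \in code_tuples F n k ->
  #|fibre Cs| = #|fibre (row_spaces (code k (fun=> 1%:M)))|.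
Proof.
move=> /unit_of_code_tuple[g0 ug0 <-].
pose f g : {ffun 'I_D -> 'M[F]_n} := [ffun i => g i *m g0 i].
have u0 i : g0 i \in unitmx by move: ug0; rewrite inE => /forallP.
have f_inj : injective f.
  move=> g h /ffunP e; apply/ffunP => i; have := e i; rewrite !ffunE.
  by move/(congr1 (fun X => X *m invmx (g0 i))); rewrite !mulmxK.
rewrite -(card_preimset _ f_inj); apply: eq_card => g; rewrite !inE.
congr (_ && _).
  by apply: eq_forallb => i; rewrite ffunE unitmx_mul u0 andbT.
apply/eqP/eqP => /ffunP e; apply/ffunP => i; have /setP := e i => {e}; rewrite !ffunE /code => e.
  apply/setP => v; have := e (v *m g0 i); rewrite !inE mulmx1 ffunE mulmxA.
  by rewrite !submxMfree // row_free_unit.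
apply/setP => v; have := e (v *m invmx (g0 i)); rewrite !inE mulmx1 ffunE mulmxA.
by rewrite -{3 4}[v](mulmxKV (u0 i)) !submxMfree // row_free_unit.
Qed.

Lemma prob_by_units (R : realType) (rho eps : R) (bad : {set {ffun 'I_D -> 'M[F]_n}}) :
  (forall g, g \in units -> g \notin bad -> product_expanding rho (row_spaces (code k g))) ->
  #|bad|%:R <= eps * #|units|%:R ->
  1 - eps <= prob_expanding F n k rho.
Proof.
move=> hgood hbad; rewrite /prob_expanding.
set Good := [set Cs in _ | _]; set CT := code_tuples F n k in Good *.
set one : {ffun 'I_D -> 'M[F]_n} := [ffun=> 1%:M].
have one_u : one \in units by rewrite inE; apply/forallP => i; rewrite ffunE unitmx1.
set f := #|fibre (row_spaces (code k (fun=> 1%:M)))|.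
have sumf (A : {set {ffun 'I_D -> {set 'rV[F]_n}}}) : A \subset CT ->
    (#|A| * f = #|[set g in units | row_spaces (code k g) \in A]|)%N.
  move=> AC; rewrite -[RHS]sum1_card (partition_big (fun g => row_spaces (code k g)) (mem A)) /=.
    rewrite -sum_nat_const; apply: eq_bigr => Cs CsA.
    rewrite /f -(card_fibre (subsetP AC _ CsA)) -sum1_card; apply: eq_bigl => g.
    by rewrite !inE; case: eqP => [->|_]; rewrite ?CsA ?andbT ?andbF.
  by move=> g; rewrite inE => /andP[].
have eCT : (#|CT| * f)%N = #|units|.
  rewrite sumf //; apply: eq_card => g; rewrite inE.
  by case ug : (g \in units) => //=; rewrite code_tuple_unit.
have f0 : 0 < f%:R :> R.
  rewrite ltr0n card_gt0; apply/set0Pn; exists one; rewrite inE one_u; apply/eqP/ffunP => i.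
  by rewrite !ffunE /code ffunE.
have CT0 : 0 < #|CT|%:R :> R.
  by rewrite ltr0n card_gt0; apply/set0Pn; exists (row_spaces (code k one)); exact: code_tuple_unit.
have GC : Good \subset CT by apply/subsetP => Cs; rewrite inE => /andP[].
have hG : (#|units| <= #|Good| * f + #|bad|)%N.
  rewrite (sumf _ GC); apply: leq_trans (leq_card_setU _ _); apply: subset_leq_card.
  apply/subsetP => g ug; rewrite !in_setU !inE; case gb : (g \in bad); rewrite ?orbT // orbF.
  move: (ug); rewrite inE => ->; rewrite /= hgood ?gb // andbT.
  by have := code_tuple_unit ug; rewrite inE.
rewrite ler_pdivlMr // -(ler_pM2r f0) -mulrA -!natrM eCT mulrBl mul1r lerBlDr.
apply: le_trans (_ : (#|Good| * f + #|bad|)%:R <= _); first by rewrite ler_nat.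
by rewrite natrD lerD2l.
Qed.

End Sampling.

(** * Probability of failure *)

(** The family is disjoint from the family of its complements. This saves a factor 2 in the union
    bound. *)
Lemma card_minority (T : finType) (P : pred {set T}) :
  (forall U, P U -> (2 * #|U| < #|T|)%N) -> (2 * #|[set U | P U]| <= 2 ^ #|T|)%N.
Proof.
move=> hP; set A := [set U | P U].
have dis : [disjoint A & [set ~: U | U in A]].
  rewrite disjoint_subset; apply/subsetP => U; rewrite inE => /hP h1.
  rewrite inE; apply/negP => /imsetP[W]; rewrite inE => /hP h2 eU.
  by have := cardsC W; rewrite -eU; lia.
rewrite mul2n -addnn -{2}(card_imset _ (@setC_inj T)) -cardsUI.
move: dis; rewrite -setI_eq0 => /eqP ->; rewrite cards0 addn0.
by rewrite -cardsT -card_powerset powersetT; apply: subset_leq_card; exact: subsetT.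
Qed.

Lemma card_bad_units (F : finFieldType) (D n s : nat) (k : 'I_D -> nat) :
  (forall U : {set grid D n}, line_closed s U ->
     exists2 g : {ffun 'I_D -> 'M[F]_n}, forall i, g i \in unitmx & exact (code k g) U) ->
  exists2 bad : {set {ffun 'I_D -> 'M[F]_n}},
    (#|F|.-1 * #|bad| <= 2 ^ (n ^ D) * n ^ D * #|{: {ffun 'I_D -> 'M[F]_n}}|)%N &
    forall g, g \in units F D n -> g \notin bad -> forall U, line_closed s U ->
      (2 * #|U| < n ^ D)%N -> exact (code k g) U.
Proof.
move=> hex; pose P (U : {set grid D n}) := line_closedb s U && (2 * #|U| < n ^ D)%N.
pose S U := if P U then [set g : {ffun 'I_D -> 'M[F]_n} |
  [forall i, g i \in unitmx] && ~~ exactb (code k g) U] else set0.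
have cT : #|grid D n| = (n ^ D)%N by rewrite card_ffun !card_ord.
exists (\bigcup_U S U) => [|g ug gb U Us Uc]; last first.
  apply/exactP; apply: contraR gb => ne; apply/bigcupP; exists U => //.
  by rewrite /S /P (introT (line_closedP _ _) Us) Uc inE ne andbT; move: ug; rewrite inE.
have hS U : (#|F|.-1 * #|S U| <= (P U : nat) * (2 * n ^ D * #|{: {ffun 'I_D -> 'M[F]_n}}|))%N.
  rewrite /S; case PU : (P U); last by rewrite cards0 muln0.
  move/andP: PU => [/line_closedP Us _]; rewrite mul1n.
  by have [g ug exg] := hex U Us; exact: card_not_exact exg.
apply: leq_trans (leq_mul (leqnn _) (card_bigcup_le S)) _; rewrite big_distrr /=.
apply: leq_trans (leq_sum _ (fun U _ => hS U)) _; rewrite -big_distrl /=.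
have -> : (\sum_U (P U : nat) = #|[set U | P U]|)%N.
  by rewrite -sum1_card [RHS]big_mkcond; apply: eq_bigr => U _; rewrite inE; case: (P U).
rewrite -mulnA !mulnA leq_mul2r; apply/orP; right; rewrite leq_mul2r; apply/orP; right.
rewrite mulnC -cT; apply: card_minority => U /andP[_]; by rewrite cT.
Qed.

Lemma card_units_ge (F : finFieldType) (D n : nat) :
  ((#|F|.-1 - D * n) * #|{: {ffun 'I_D -> 'M[F]_n}}| <= #|F|.-1 * #|units F D n|)%N.
Proof.
have := card_not_unit F D n; set Z := [set g | _] => hZ.
have -> : #|units F D n| = (#|{: {ffun 'I_D -> 'M[F]_n}}| - #|Z|)%N.
  have -> : Z = ~: units F D n by apply/setP => g; rewrite !inE.
  by rewrite -(cardsC (units F D n)) addnK.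
by rewrite mulnBl mulnBr leq_sub2l.
Qed.

Lemma failure_boundE (R : realType) (N t : nat) :
  N%:R * (2 : R) ^ (N%:Z - t%:Z + 1) = (N * 2 ^ N.+1)%:R / (2 ^ t)%:R.
Proof.
have -> : N%:Z - t%:Z + 1 = N.+1%:Z - t%:Z by lia.
by rewrite expfzDr ?pnatr_eq0 // -exprnN -exprnP natrM !natrX mulrA.
Qed.

Lemma prob_expanding_ge (F : finFieldType) (R : realType) (D n t Gam s : nat) (k : 'I_D -> nat) :
  (0 < D)%N -> (0 < Gam)%N -> (D < n)%N -> #|F| = (2 ^ t)%N -> (0 < s)%N -> (n <= Gam * s)%N ->
  (n ^ D * 2 ^ (n ^ D).+1 < #|F|)%N -> (forall i, (k i <= n)%N) ->
  (forall U : {set grid D n}, line_closed s U ->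
     exists2 g : {ffun 'I_D -> 'M[F]_n}, forall i, g i \in unitmx & exact (code k g) U) ->
  1 - (n ^ D)%:R * (2 : R) ^ ((n ^ D)%:Z - t%:Z + 1) <=
  prob_expanding F n k ((2 * D * Gam ^ D)%:R^-1 : R).
Proof.
move=> D0 G0 Dn qt s0 nGs hq kn hex.
have [bad hbad hgood] := card_bad_units hex.
have n0 : (0 < n)%N by lia.
have nN : (n <= n ^ D)%N by rewrite -{1}(expn1 n) leq_pexp2l.
have N2 : (n ^ D < 2 ^ n ^ D)%N by exact: ltn_expl.
have qb : (2 + 2 * (D * n) <= #|F|)%N.
  apply: leq_trans hq; rewrite expnS; move: N2; move: (2 ^ n ^ D)%N => Q hQ.
  have : (D * n < Q * n ^ D)%N.
    apply: (@leq_trans (n * n ^ D)); last by rewrite leq_mul2r ltnW ?orbT // (leq_trans _ hQ).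
    apply: (@leq_trans (n * n)); first by rewrite ltn_mul2r n0.
    by rewrite leq_mul2l nN orbT.
  move: (n ^ D)%N => N; nia.
apply: (@prob_by_units F D n k kn R _ _ bad).
  move=> g ug gb.
  apply: (@expanding_of_exact F R D n Gam s _ D0 G0 n0 _ s0 nGs) => [|U Us Uc].
    by apply: leq_trans (ltnW hq); apply: leq_trans nN _; rewrite leq_pmulr ?expn_gt0.
  exact: (hgood g ug gb U Us Uc).
rewrite failure_boundE -qt.
have q0 : 0 < #|F|%:R :> R by rewrite ltr0n; lia.
rewrite mulrAC ler_pdivlMr // -!natrM ler_nat.
have := card_units_ge F D n; move: hbad.
set V := #|{: {ffun 'I_D -> 'M[F]_n}}|; set GL := #|units F D n|; set b := #|bad|; move: qb.
rewrite expnS; move: (n ^ D)%N (2 ^ _)%N (D * n)%N => N Q d.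
case: #|F| => // q /= qb hb hGL.
(* The last factor 2 pays for the singular tuples and for passing from [#|F|.-1] to [#|F|]. *)
have h1 : (q.+1 * V <= 2 * ((q - d) * V))%N by rewrite mulnA leq_mul2r; apply/orP; right; lia.
have q1 : (0 < q)%N by lia.
rewrite -(leq_pmul2l q1).
apply: (@leq_trans (q.+1 * (Q * N * V))).
  have -> : (q * (b * q.+1) = q.+1 * (q * b))%N by ring.
  by rewrite leq_mul2l hb orbT.
have -> : (q.+1 * (Q * N * V) = Q * N * (q.+1 * V))%N by ring.
apply: leq_trans (leq_mul (leqnn _) h1) _.
apply: leq_trans (leq_mul (leqnn _) (leq_mul (leqnn _) hGL)) _.
by apply: eq_leq; ring.
Qed.

Lemma prob_expanding_one (F : finFieldType) (R : realType) (D n : nat) (k : 'I_D -> nat)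
    (rho : R) : (forall i, (k i <= n)%N) ->
  (forall M : 'I_D -> 'M[F]_n, product_expanding rho (row_spaces M)) ->
  1 <= prob_expanding F n k rho.
Proof.
move=> kn h; have := @prob_by_units F D n k kn R rho 0 set0; rewrite subr0; apply.
  by move=> g _ _; exact: h.
by rewrite cards0 mul0r.
Qed.

Theorem theorem1 (R : realType) (D : nat) (Rs : 'I_D -> R) :
  (forall i, 0 < Rs i < 1) ->
  exists rho : R, 0 < rho /\
    forall (n t : nat) (F : finFieldType), #|F| = (2 ^ t)%N ->
    forall k : 'I_D -> nat, (forall i, (k i)%:R <= n%:R * Rs i) ->
      1 - (n ^ D)%:R * (2 : R) ^ ((n ^ D)%:Z - t%:Z + 1)
        <= prob_expanding F n k rho.
Proof.
move=> hR.
have kn n (k : 'I_D -> nat) : (forall i, (k i)%:R <= n%:R * Rs i) -> forall i, (k i <= n)%N.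
  move=> hk i; have /andP[_ /ltW R1] := hR i.
  by rewrite -(ler_nat R); apply: le_trans (hk i) _; rewrite ler_piMr.
have bound_le1 n t : 1 - (n ^ D)%:R * (2 : R) ^ ((n ^ D)%:Z - t%:Z + 1) <= 1.
  by rewrite lerBlDr lerDl mulr_ge0 // exprz_ge0.
have [D0|D0] := posnP D.
  exists 1%:R^-1; split=> [|n t F _ k /kn kle]; first by rewrite invr_gt0.
  apply: le_trans (bound_le1 n t) (prob_expanding_one kle _) => M.
  apply: product_expandingP => // a _; rewrite big1 ?eqxx // => i _.
  by have := ltn_ord i; rewrite {2}D0.
(* [e] is chosen so that [2 / e <= 1 - Rs i] for all [i]; the final [.+2] ensures [1 < e]. *)
pose e := (\sum_i Num.bound (2 / (1 - Rs i))).+2.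
have he i : 2 <= e%:R * (1 - Rs i).
  have /andP[_ R1] := hR i; have d0 : 0 < 1 - Rs i by rewrite subr_gt0.
  rewrite -ler_pdivrMr //; apply: le_trans (ltW (archi_boundP _)) _.
    by rewrite divr_ge0 // ltW.
  by rewrite ler_nat /e (bigD1 i) //= -!addnS leq_addr.
have [Gam G0 hGam] := exact_of_line_closed D0 (isT : 1 < e)%N.
(* The summand [D] guarantees [D < n] for the lengths above [G]. *)
pose G := (Gam + D)%N; have GG : (0 < G)%N by rewrite addn_gt0 G0.
exists (2 * D * G ^ D)%:R^-1; split.
  by rewrite invr_gt0 ltr0n !muln_gt0 D0 expn_gt0 GG.
move=> n t F qt k hk; have kle := kn n k hk.
have [nG|nG] := leqP n G.
  apply: le_trans (bound_le1 n t) (prob_expanding_one kle _) => M.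
  exact: expanding_small.
(* Over a small field the claimed lower bound is at most 0. *)
have [hq|hq] := leqP #|F| (n ^ D * 2 ^ (n ^ D).+1).
  apply: le_trans (_ : 0 <= _); last by rewrite divr_ge0.
  rewrite failure_boundE -qt subr_le0 ler_pdivlMr ?mul1r ?ler_nat //.
  by rewrite ltr0n; apply/card_gt0P; exists 0.
have [|s [s0 nGs hex]] := hGam n; first by rewrite /G in nG; lia.
apply: (@prob_expanding_ge F R D n t G s k D0 GG _ qt s0 _ hq kle) => [||U Us].
- by rewrite /G in nG; lia.
- by apply: leq_trans nGs _; rewrite leq_mul2r /G leq_addr orbT.
apply: hex => // i; rewrite -(ler_nat R) !natrM natrB //.
have e0 : 0 <= e%:R :> R by [].
apply: le_trans (ler_wpM2l e0 (hk i)) _; rewrite -subr_ge0.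
have -> : (e%:R - 2) * n%:R - e%:R * (n%:R * Rs i) = n%:R * (e%:R * (1 - Rs i) - 2) by ring.
by rewrite mulr_ge0 // subr_ge0.
Qed.
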